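(* Let $(m_j)_{j=1}^{\infty}$ be a strictly increasing sequence of positive integers with $m_{j+1}\ge q\,m_j$ for all $j$, where $q\ge 2$, and let $p>0$. Let $A_j>0$, $B_j\in\mathbb{C}$ satisfy $A_j^2-|B_j|^2=1$ for all $j$. For $N\in\mathbb{N}$ let $g_N\colon\mathbb{T}\to\mathrm{SU}(1,1)$ be the partial product $$g_N(t)=\prod_{j=1}^{N}\begin{bmatrix} A_j & B_j e^{2\pi i m_j t}\\ \overline{B_j}e^{-2\pi i m_j t} & A_j\end{bmatrix}$$ (factors multiplied in increasing order of $j$ from left to right). Then the sequence $(g_N)_{N\in\mathbb{N}}$ converges in the metric space $(\mathrm{L}^p(\mathbb{T},\mathrm{SU}(1,1)),d_p)$ if and only if $\sum_{j=1}^{\infty}\log(A_j^2+|B_j|^2)<\infty$.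
   Context: $\mathbb{T}=\mathbb{R}/\mathbb{Z}$ with Lebesgue measure. $\mathrm{SU}(1,1)=\{\begin{bmatrix} A & B\\ \overline{B} & \overline{A}\end{bmatrix}: A,B\in\mathbb{C},\ |A|^2-|B|^2=1\}$. On $\mathrm{SU}(1,1)$ define the metric $\rho(G_1,G_2)=\log(1+\|G_1^{-1}G_2-I_2\|_{op})$, where $\|\cdot\|_{op}$ is the operator (spectral) norm and $I_2$ the $2\times 2$ identity. For measurable $g_1,g_2\colon\mathbb{T}\to\mathrm{SU}(1,1)$ (identified when equal a.e.), set $d_p(g_1,g_2)=\|\rho(g_1(t),g_2(t))\|_{\mathrm{L}^p_t(\mathbb{T})}$ if $p\ge1$ and $d_p(g_1,g_2)=\|\rho(g_1(t),g_2(t))\|_{\mathrm{L}^p_t(\mathbb{T})}^p$ if $0<p<1$. Let $I(t)=I_2$ for all $t$, and $\mathrm{L}^p(\mathbb{T},\mathrm{SU}(1,1))$ the set of measurable $g\colon\mathbb{T}\to\mathrm{SU}(1,1)$ with $d_p(I,g)<\infty$; it is a complete metric space with metric $d_p$. The condition $\sum_j\log(A_j^2+|B_j|^2)<\infty$ is referred to as the product having $\ell^2$ coefficients (equivalently $\sum_j|B_j|^2<\infty$). *)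

(* Defs.v *)
From mathcomp Require Import all_boot all_order all_algebra.
From mathcomp Require Import all_classical all_reals all_analysis.
From mathcomp.real_closed Require Import complex.

Set Implicit Arguments.
Unset Strict Implicit.
Unset Printing Implicit Defensive.

Import Order.TTheory GRing.Theory Num.Theory.
Import numFieldNormedType.Exports.
Local Open Scope classical_set_scope.
Local Open Scope ring_scope.

Section SU11defs.
Variable R : realType.

Definition cabs (z : R[i]) : R := Normc.normc z.

Definition vnorm (v : 'cV[R[i]]_2) : R :=
  Num.sqrt (cabs (v 0 0) ^+ 2 + cabs (v 1 0) ^+ 2).

Definition opnorm (M : 'M[R[i]]_2) : R :=
  sup [set r | exists v : 'cV[R[i]]_2, vnorm v = 1 /\ r = vnorm (M *m v)].

Definition SU11 (G : 'M[R[i]]_2) : Prop :=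
  G 1 1 = conjc (G 0 0) /\ G 1 0 = conjc (G 0 1) /\
  cabs (G 0 0) ^+ 2 - cabs (G 0 1) ^+ 2 = 1.

Definition rho (G1 G2 : 'M[R[i]]_2) : R :=
  ln (1 + opnorm (invmx G1 *m G2 - 1%:M)).

Definition expi (x : R) : R[i] := (cos x +i* sin x)%C.

Definition mx2 (a b c d : R[i]) : 'M[R[i]]_2 :=
  \matrix_(i < 2, j < 2)
    if (i == 0 :> nat) then (if (j == 0 :> nat) then a else b)
    else (if (j == 0 :> nat) then c else d).

Definition factor (A : R) (B : R[i]) (m : nat) (t : R) : 'M[R[i]]_2 :=
  mx2 (A%:C)%C (B * expi (2 * pi * m%:R * t))
      (conjc B * expi (- (2 * pi * m%:R * t))) (A%:C)%C.

Definition gN (A : nat -> R) (B : nat -> R[i]) (m : nat -> nat) (N : nat) (t : R)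
  : 'M[R[i]]_2 := \prod_(j < N) factor (A j) (B j) (m j) t.

(* the torus T = R/Z is represented by the fundamental domain [0,1]
   with Lebesgue measure; functions are R -> 'M_2, only values on [0,1] matter *)
Definition torus : set R := `[0%R, 1%R]%classic.

Definition rho_int (p : R) (g1 g2 : R -> 'M[R[i]]_2) : \bar R :=
  (\int[lebesgue_measure]_(t in torus) ((rho (g1 t) (g2 t)) `^ p)%:E)%E.

Definition dp (p : R) (g1 g2 : R -> 'M[R[i]]_2) : \bar R :=
  if 1 <= p then ((rho_int p g1 g2) `^ p^-1)%E else rho_int p g1 g2.

Definition Ifun : R -> 'M[R[i]]_2 := fun _ => 1%:M.

Definition mx_measurable (g : R -> 'M[R[i]]_2) : Prop :=
  forall i j : 'I_2,
    measurable_fun torus (fun t => complex.Re (g t i j)) /\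
    measurable_fun torus (fun t => complex.Im (g t i j)).

Definition Lp_SU11 (p : R) (g : R -> 'M[R[i]]_2) : Prop :=
  mx_measurable g /\ (forall t, torus t -> SU11 (g t)) /\ (dp p Ifun g < +oo)%E.

Definition converges_Lp (p : R) (u : nat -> R -> 'M[R[i]]_2) : Prop :=
  (forall N, Lp_SU11 p (u N)) /\
  exists g, Lp_SU11 p g /\ ((fun N => dp p (u N) g) @ \oo --> 0%E).

End SU11defs.

(* Main.v *)
(* Idea. Write [a, b] for the entries of the partial product over [M <= j < N]
   and [S_j = A_j^2 + |B_j|^2]. As [m_{j+1} >= 2 m_j], the product [a * conj b]
   has no frequency [-m_N], so the cross term created by one more factor has mean
   zero; hence [|a|^2 + |b|^2] has mean [prod S_j], while [a] has mean [prod A_j].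

   Sufficiency: [|a - 1|^2 + |b|^2] has mean
   [prod S_j + 1 - 2 prod A_j <= prod S_j - 1], which is small for late blocks.
   Since [ln(1+x)^p <= e + C x^2], the sequence is Cauchy; a fast subsequence
   converges almost everywhere, and Fatou's lemma identifies the limit.

   Necessity: if [sum ln S_j] over a block is between 1 and 2, then [|a|] has mean
   at least [prod A_j >= e^{1/4}] and second moment at most [e^2], so [rho] of the
   block is bounded below in L^p. For a Cauchy sequence single steps are small, so
   tail sums of [ln S_j] stay below 1. *)
Require Import Defs.
From mathcomp Require Import all_boot all_order all_algebra.
From mathcomp Require Import all_classical all_reals all_analysis.
From mathcomp.real_closed Require Import complex.
From mathcomp Require Import measurable_realfun.
From mathcomp Require Import ring lra zify.

Set Implicit Arguments.
Unset Strict Implicit.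
Unset Printing Implicit Defensive.

Import Order.TTheory GRing.Theory Num.Theory.
Import numFieldNormedType.Exports.
Local Open Scope classical_set_scope.
Local Open Scope ring_scope.

(** The obstacle is that [rho] is a logarithm and [p] is arbitrary, so orthogonality says nothing
    about [dp] directly. Only quadratic functions of the entries are computed, and two scalar
    inequalities translate between them and powers of [ln (1 + x)]. Left invariance of [rho] turns
    the distance between two partial products into the distance of a block from the identity, which
    is why all means are computed for blocks with an arbitrary left end.

    A finite [dp] gives no integrability of the entries, so the limit is built pointwise: if the
    operator norms of [invmx (G k) *m G k.+1 - 1] are summable, the first rows converge, and the
    relation |a|^2 - |b|^2 = 1 passes to the limit. Estimates are kept at the level of [rho_int],
    the integral without the root, where a triangle inequality up to the constant 2^p suffices and
    all p > 0 are alike. *)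

(** * Modulus, conjugation and phase of complex numbers *)

Section ComplexModulus.
Variable R : realType.
Implicit Types z w : R[i].

Lemma conjcD z w : conjc (z + w) = conjc z + conjc w. Proof. exact: rmorphD. Qed.

Lemma conjcB z w : conjc (z - w) = conjc z - conjc w. Proof. exact: rmorphB. Qed.

Lemma conjcN z : conjc (- z) = - conjc z. Proof. exact: rmorphN. Qed.

Lemma conjcM z w : conjc (z * w) = conjc z * conjc w. Proof. exact: rmorphM. Qed.

Lemma Re_add z w : complex.Re (z + w) = complex.Re z + complex.Re w.
Proof. by case: z; case: w. Qed.

Lemma Im_add z w : complex.Im (z + w) = complex.Im z + complex.Im w.
Proof. by case: z; case: w. Qed.

Lemma Re_sub z w : complex.Re (z - w) = complex.Re z - complex.Re w.
Proof. by case: z; case: w. Qed.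

Lemma Im_sub z w : complex.Im (z - w) = complex.Im z - complex.Im w.
Proof. by case: z; case: w. Qed.

Lemma Re_mul z w : complex.Re (z * w) =
  complex.Re z * complex.Re w - complex.Im z * complex.Im w.
Proof. by case: z; case: w. Qed.

Lemma Im_mul z w : complex.Im (z * w) =
  complex.Re z * complex.Im w + complex.Im z * complex.Re w.
Proof. by case: z => a b; case: w. Qed.

Lemma Re_conjc z : complex.Re (conjc z) = complex.Re z. Proof. by case: z. Qed.

Lemma Im_conjc z : complex.Im (conjc z) = - complex.Im z. Proof. by case: z. Qed.

Lemma cabs_ge0 z : 0 <= cabs z. Proof. by case: z => x y; exact: sqrtr_ge0. Qed.

Lemma sqr_cabs z : cabs z ^+ 2 = complex.Re z ^+ 2 + complex.Im z ^+ 2.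
Proof. by case: z => x y; rewrite sqr_sqrtr // addr_ge0 ?sqr_ge0. Qed.

Lemma cabsM z w : cabs (z * w) = cabs z * cabs w.
Proof. exact: Normc.normcM. Qed.

Lemma cabsD z w : cabs (z + w) <= cabs z + cabs w.
Proof. exact: le_normcD. Qed.

Lemma cabsN z : cabs (- z) = cabs z. Proof. exact: normcN. Qed.

Lemma cabs0 : cabs (0 : R[i]) = 0. Proof. exact: Normc.normc0. Qed.

Lemma cabs1 : cabs (1 : R[i]) = 1. Proof. exact: Normc.normc1. Qed.

Lemma cabs_conjc z : cabs (conjc z) = cabs z.
Proof. by case: z => x y; rewrite /cabs /= sqrrN. Qed.

Lemma cabs_real (x : R) : 0 <= x -> cabs (x%:C)%C = x.
Proof. by move=> x0; rewrite /cabs /= expr0n addr0 sqrtr_sqr ger0_norm. Qed.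

Lemma le_Re_cabs z : complex.Re z <= cabs z.
Proof.
apply: le_trans (ler_norm _) _; rewrite -(ler_pXn2r (n := 2)) ?nnegrE ?cabs_ge0 //.
by rewrite sqr_cabs real_normK ?num_real // lerDl sqr_ge0.
Qed.

Lemma le_norm_Re_cabs z : `|complex.Re z| <= cabs z.
Proof.
rewrite -(ler_pXn2r (n := 2)) ?nnegrE ?cabs_ge0 //.
by rewrite sqr_cabs real_normK ?num_real // lerDl sqr_ge0.
Qed.

Lemma le_norm_Im_cabs z : `|complex.Im z| <= cabs z.
Proof.
rewrite -(ler_pXn2r (n := 2)) ?nnegrE ?cabs_ge0 //.
by rewrite sqr_cabs real_normK ?num_real // lerDr sqr_ge0.
Qed.

Lemma mul_conjc z : z * conjc z = ((cabs z ^+ 2)%:C)%C.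
Proof.
rewrite sqr_cabs; case: z => x y; apply/eqP; rewrite eq_complex /=.
by apply/andP; split; apply/eqP; ring.
Qed.

(* The value [1] at [z = 0] keeps the phase unimodular. *)
Definition phase z : R[i] := if z == 0 then 1 else conjc z * ((cabs z)^-1%:C)%C.

Lemma cabs_eq0 z : (cabs z == 0) = (z == 0).
Proof.
by apply/eqP/eqP => [/Normc.eq0_normc //|->]; exact: cabs0.
Qed.

Lemma cabs_phase z : cabs (phase z) = 1.
Proof.
rewrite /phase; case: eqP => [_|/eqP z0]; first exact: cabs1.
by rewrite cabsM cabs_conjc cabs_real ?invr_ge0 ?cabs_ge0 // mulfV // cabs_eq0.
Qed.

Lemma mul_phase z : z * phase z = ((cabs z)%:C)%C.
Proof.
rewrite /phase; case: eqP => [->|/eqP z0]; first by rewrite cabs0 mul0r.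
rewrite mulrA mul_conjc -rmorphM /= expr2 mulfK // cabs_eq0 //.
Qed.

Lemma mul_phase_conjc z : conjc z = (cabs z)%:C%C * phase z.
Proof.
rewrite /phase; case: eqP => [->|/eqP z0]; first by rewrite cabs0 mul0r conjc0.
by rewrite mulrCA -rmorphM /= mulfV ?cabs_eq0 // mulr1.
Qed.

End ComplexModulus.

(** * Algebra of SU(1,1), the operator norm in closed form, and the metric [rho] *)

Section SU11Matrices.
Variable R : realType.
Implicit Types (a b c d : R[i]) (G H K : 'M[R[i]]_2).

(** The shape shared by the elements of SU(1,1) and by their differences with the identity. It is
    stable under products, so all matrix computations reduce to the first row. *)
Definition conj_mx2 a b : 'M[R[i]]_2 := mx2 a b (conjc b) (conjc a).

Lemma mx2E a b c d :
  (mx2 a b c d 0 0 = a) * (mx2 a b c d 0 1 = b) * (mx2 a b c d 1 0 = c)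
  * (mx2 a b c d 1 1 = d).
Proof. by do !split; rewrite mxE. Qed.

Lemma matrix2P G H : G 0 0 = H 0 0 -> G 0 1 = H 0 1 -> G 1 0 = H 1 0 ->
  G 1 1 = H 1 1 -> G = H.
Proof.
move=> h00 h01 h10 h11; apply/matrixP => i j.
have ordE (k : 'I_2) : k = 0 \/ k = 1.
  by case: k => [[|[|//]] kP]; [left|right]; apply/val_inj.
by case: (ordE i) (ordE j) => -> [] ->.
Qed.

Lemma mx2_mul a b c d a' b' c' d' :
  mx2 a b c d *m mx2 a' b' c' d' =
  mx2 (a * a' + b * c') (a * b' + b * d') (c * a' + d * c') (c * b' + d * d').
Proof.
by apply: matrix2P; rewrite [LHS]mxE big_ord_recl big_ord1 !mxE.
Qed.

Lemma conj_mx2M a b c d : conj_mx2 a b *m conj_mx2 c d =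
  conj_mx2 (a * c + b * conjc d) (a * d + b * conjc c).
Proof.
by rewrite /conj_mx2 mx2_mul !conjcD !conjcM !conjcK; congr mx2; exact: addrC.
Qed.

Lemma conj_mx2_sub1 a b : conj_mx2 a b - 1%:M = conj_mx2 (a - 1) b.
Proof.
by apply: matrix2P; rewrite !mxE //= ?subr0 // conjcB conjc1.
Qed.

Lemma SU11P G : SU11 G <->
  G = conj_mx2 (G 0 0) (G 0 1) /\ cabs (G 0 0) ^+ 2 - cabs (G 0 1) ^+ 2 = 1.
Proof.
split=> [[h11 [h10 h]]|[-> h]].
  by split=> //; apply: matrix2P; rewrite !mx2E.
by move: h; rewrite /SU11 !mx2E.
Qed.

Lemma conj_mx2_1 : 1%:M = conj_mx2 1 0 :> 'M[R[i]]_2.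
Proof. by apply: matrix2P; rewrite !mxE ?conjc0 ?conjc1. Qed.

Lemma SU11_conj_mx2 a b : cabs a ^+ 2 - cabs b ^+ 2 = 1 -> SU11 (conj_mx2 a b).
Proof. by move=> h; apply/SU11P; rewrite !mx2E. Qed.

Lemma SU11_1 : SU11 (1%:M : 'M[R[i]]_2).
Proof.
rewrite conj_mx2_1; apply: SU11_conj_mx2.
by rewrite cabs0 cabs1 expr1n expr0n subr0.
Qed.

Lemma conj_mx2V a b : cabs a ^+ 2 - cabs b ^+ 2 = 1 ->
  conj_mx2 a b *m conj_mx2 (conjc a) (- b) = 1%:M.
Proof.
move=> h; rewrite conj_mx2M conj_mx2_1; congr conj_mx2; last first.
  by rewrite conjcK; ring.
by rewrite conjcN mulrN !mul_conjc -rmorphB h.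
Qed.

Lemma invmx_conj_mx2 a b : cabs a ^+ 2 - cabs b ^+ 2 = 1 ->
  invmx (conj_mx2 a b) = conj_mx2 (conjc a) (- b).
Proof.
move=> /conj_mx2V h; have [u _] := mulmx1_unit h.
by rewrite -[LHS]mulmx1 -h mulmxA mulVmx // mul1mx.
Qed.

Lemma SU11_unit G : SU11 G -> G \in unitmx.
Proof.
move=> /SU11P [GE h]; rewrite GE; by have [u _] := mulmx1_unit (conj_mx2V h).
Qed.

Lemma SU11_inv G : SU11 G -> SU11 (invmx G).
Proof.
move=> /SU11P [GE h]; rewrite GE invmx_conj_mx2 //; apply: SU11_conj_mx2.
by rewrite cabsN cabs_conjc.
Qed.

Lemma SU11_mul G H : SU11 G -> SU11 H -> SU11 (G *m H).
Proof.
move=> /SU11P [-> h] /SU11P [-> h']; rewrite conj_mx2M; apply: SU11_conj_mx2.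
move: h h'; rewrite !mx2E !sqr_cabs; move: (G 0 0) (G 0 1) (H 0 0) (H 0 1).
move=> [a1 a2] [b1 b2] [c1 c2] [d1 d2] /= h h'.
transitivity ((a1 ^+ 2 + a2 ^+ 2 - (b1 ^+ 2 + b2 ^+ 2)) *
  (c1 ^+ 2 + c2 ^+ 2 - (d1 ^+ 2 + d2 ^+ 2))); last by rewrite h h' mulr1.
ring.
Qed.

(** The triangle inequality in each coordinate replaces the matrix by the real symmetric one with
    rows (|a|, |b|) and (|b|, |a|), whose largest eigenvalue is |a| + |b|. *)
Lemma vnorm_conj_mx2 a b (v : 'cV[R[i]]_2) :
  vnorm (conj_mx2 a b *m v) <= (cabs a + cabs b) * vnorm v.
Proof.
have K0 : 0 <= cabs a + cabs b by rewrite addr_ge0 ?cabs_ge0.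
rewrite /vnorm -(ler_pXn2r (n := 2)) ?nnegrE ?mulr_ge0 ?sqrtr_ge0 //.
rewrite exprMn !sqr_sqrtr ?addr_ge0 ?sqr_ge0 //.
rewrite !mxE !big_ord_recl !big_ord0 !addr0 !mxE /=.
rewrite (_ : lift _ _ = 1 :> 'I_2); last exact/val_inj.
set x := v 0 0; set y := v 1 0.
have h1 : cabs (a * x + b * y) <= cabs a * cabs x + cabs b * cabs y.
  by apply: le_trans (cabsD _ _) _; rewrite !cabsM.
have h2 : cabs (conjc b * x + conjc a * y) <= cabs b * cabs x + cabs a * cabs y.
  by apply: le_trans (cabsD _ _) _; rewrite !cabsM !cabs_conjc.
have k1 : cabs (a * x + b * y) ^+ 2 <= (cabs a * cabs x + cabs b * cabs y) ^+ 2.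
  by rewrite ler_pXn2r ?nnegrE ?cabs_ge0 ?addr_ge0 ?mulr_ge0 ?cabs_ge0.
have k2 : cabs (conjc b * x + conjc a * y) ^+ 2
    <= (cabs b * cabs x + cabs a * cabs y) ^+ 2.
  by rewrite ler_pXn2r ?nnegrE ?cabs_ge0 ?addr_ge0 ?mulr_ge0 ?cabs_ge0.
apply: le_trans (lerD k1 k2) _.
rewrite -subr_ge0.
have -> : (cabs a + cabs b) ^+ 2 * (cabs x ^+ 2 + cabs y ^+ 2) -
  ((cabs a * cabs x + cabs b * cabs y) ^+ 2 +
   (cabs b * cabs x + cabs a * cabs y) ^+ 2) =
  2 * (cabs a * cabs b) * (cabs x - cabs y) ^+ 2 by ring.
by rewrite mulr_ge0 ?sqr_ge0 // mulr_ge0 // mulr_ge0 ?cabs_ge0.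
Qed.

(* The norm is attained at the vector whose entries have the phases that make
   all the terms of [conj_mx2 a b *m v] point in a common direction. *)
Lemma opnorm_conj_mx2 a b : opnorm (conj_mx2 a b) = cabs a + cabs b.
Proof.
rewrite /opnorm; set S := (X in sup X).
have ubS : ubound S (cabs a + cabs b).
  by move=> _ [v [v1 ->]]; rewrite (le_trans (vnorm_conj_mx2 _ _ _)) // v1 mulr1.
suff inS : S (cabs a + cabs b).
  apply/eqP; rewrite eq_le; apply/andP; split; first by apply: ge_sup => //; exists (cabs a + cabs b).
  by apply: ub_le_sup => //; exists (cabs a + cabs b).
pose s : R := (Num.sqrt 2)^-1.
have s0 : 0 <= s by rewrite invr_ge0 sqrtr_ge0.
have s2 : s ^+ 2 = 2^-1 by rewrite exprVn sqr_sqrtr // ler0n.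
pose v : 'cV[R[i]]_2 := \col_i ((s%:C)%C * (if i == 0 then phase a else phase b)).
have K0 : 0 <= cabs a + cabs b by rewrite addr_ge0 ?cabs_ge0.
exists v; split.
  rewrite /vnorm !mxE /= !cabsM !cabs_phase !mulr1 cabs_real // s2.
  by rewrite (_ : 2^-1 + 2^-1 = 1) ?sqrtr1 //; lra.
have e0 : (conj_mx2 a b *m v) 0 0 = (s%:C)%C * ((cabs a + cabs b)%:C)%C.
  rewrite mxE big_ord_recl big_ord1 !mxE /= rmorphD /= -!mul_phase; ring.
have e1 : (conj_mx2 a b *m v) 1 0 =
    (s%:C)%C * ((cabs a + cabs b)%:C)%C * phase a * phase b.
  rewrite mxE big_ord_recl big_ord1 !mxE /= rmorphD !mul_phase_conjc; ring.
rewrite /vnorm e0 e1 !cabsM !cabs_phase !mulr1 !cabs_real // exprMn s2.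
rewrite (_ : _ + _ = (cabs a + cabs b) ^+ 2); last by field.
by rewrite sqrtr_sqr ger0_norm.
Qed.

(** On SU(1,1) this is the operator norm of [G - 1], since [G - 1] still has the shape
    [conj_mx2]. *)
Definition dist1 G : R := cabs (G 0 0 - 1) + cabs (G 0 1).

Lemma dist1_ge0 G : 0 <= dist1 G.
Proof. by rewrite addr_ge0 ?cabs_ge0. Qed.

Lemma opnorm_sub1 G : SU11 G -> opnorm (G - 1%:M) = dist1 G.
Proof.
by move=> /SU11P [-> _]; rewrite conj_mx2_sub1 opnorm_conj_mx2 /dist1 !mx2E.
Qed.

Lemma rhoE G H : SU11 G -> SU11 H -> rho G H = ln (1 + dist1 (invmx G *m H)).
Proof.
by move=> hG hH; rewrite /rho opnorm_sub1 //; apply: SU11_mul => //; apply: SU11_inv.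
Qed.

Lemma dist1_inv G : SU11 G -> dist1 (invmx G) = dist1 G.
Proof.
move=> /SU11P [GE h]; rewrite GE invmx_conj_mx2 // /dist1 !mx2E cabsN; congr (_ + _).
by rewrite -[LHS]cabs_conjc conjcB conjcK conjc1.
Qed.

(** Follows from GH - 1 = (G - 1) + (H - 1) + (G - 1)(H - 1), read on the first row. Taking
    logarithms gives the triangle inequality for [rho]. *)
Lemma dist1_mul G H : SU11 G -> SU11 H ->
  1 + dist1 (G *m H) <= (1 + dist1 G) * (1 + dist1 H).
Proof.
move=> /SU11P [-> _] /SU11P [-> _]; rewrite conj_mx2M /dist1 !mx2E.
move: (G 0 0) (G 0 1) (H 0 0) (H 0 1) => a b c d.
have -> : a * c + b * conjc d - 1 =
   (a - 1) + (c - 1) + (a - 1) * (c - 1) + b * conjc d by ring.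
have -> : a * d + b * conjc c = d + (a - 1) * d + b + b * conjc (c - 1).
  by rewrite conjcB conjc1; ring.
have h1 := cabsD ((a - 1) + (c - 1) + (a - 1) * (c - 1)) (b * conjc d).
have h2 := cabsD ((a - 1) + (c - 1)) ((a - 1) * (c - 1)).
have h3 := cabsD (a - 1) (c - 1).
have h4 := cabsD (d + (a - 1) * d + b) (b * conjc (c - 1)).
have h5 := cabsD (d + (a - 1) * d) b.
have h6 := cabsD d ((a - 1) * d).
move: h1 h2 h3 h4 h5 h6; rewrite !cabsM !cabs_conjc; lra.
Qed.

(** The left side is read off the first row of G(H - 1). With [H] the quotient of two successive
    terms, smallness in the left-invariant metric becomes smallness of the increments of the
    entries. *)
Lemma SU11_step G H : SU11 G -> SU11 H ->
  cabs ((G *m H) 0 0 - G 0 0) + cabs ((G *m H) 0 1 - G 0 1) <=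
  (cabs (G 0 0) + cabs (G 0 1)) * dist1 H.
Proof.
move=> /SU11P [-> _] /SU11P [-> _]; rewrite conj_mx2M /dist1 !mx2E.
move: (G 0 0) (G 0 1) (H 0 0) (H 0 1) => a b c d.
have -> : a * c + b * conjc d - a = a * (c - 1) + b * conjc d by ring.
have -> : a * d + b * conjc c - b = a * d + b * conjc (c - 1).
  by rewrite conjcB conjc1; ring.
have h1 := cabsD (a * (c - 1)) (b * conjc d).
have h2 := cabsD (a * d) (b * conjc (c - 1)).
move: h1 h2; rewrite !cabsM !cabs_conjc; lra.
Qed.

Lemma rho_triangle G H K : SU11 G -> SU11 H -> SU11 K ->
  rho G K <= rho G H + rho H K.
Proof.
move=> hG hH hK; rewrite !rhoE // -lnM ?posrE ?ltr_pwDl ?dist1_ge0 //.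
rewrite ler_ln ?posrE ?mulr_gt0 ?ltr_pwDl ?dist1_ge0 //.
have -> : invmx G *m K = (invmx G *m H) *m (invmx H *m K).
  by rewrite mulmxA mulmxK // SU11_unit.
by apply: dist1_mul; apply: SU11_mul => //; apply: SU11_inv.
Qed.

Lemma rhoC G H : SU11 G -> SU11 H -> rho G H = rho H G.
Proof.
move=> hG hH; rewrite !rhoE // -[in RHS]dist1_inv; last first.
  by apply: SU11_mul => //; apply: SU11_inv.
by rewrite -!/(_^-1) invrM ?invrK // ?unitrV; apply: SU11_unit.
Qed.

Lemma rho_ge0 G H : SU11 G -> SU11 H -> 0 <= rho G H.
Proof. by move=> hG hH; rewrite rhoE // ln_ge0 // lerDl dist1_ge0. Qed.

End SU11Matrices.

(** * Trigonometric polynomials on the torus, their frequencies and their means *)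

Section TrigonometricPolynomials.
Variable R : realType.
Implicit Types (x y t : R) (f g : R -> R[i]) (n : int).

Lemma expiD x y : expi (x + y) = expi x * expi y.
Proof.
rewrite /expi cosD sinD; apply/eqP; rewrite eq_complex /=.
by apply/andP; split; apply/eqP; ring.
Qed.

Lemma expi0 : expi (0 : R) = 1.
Proof. by rewrite /expi cos0 sin0. Qed.

Lemma expiN x : expi (- x) = conjc (expi x).
Proof. by rewrite /expi cosN sinN. Qed.

Lemma cabs_expi x : cabs (expi x) = 1.
Proof.
apply/eqP; rewrite -(eqrXn2 (n := 2)) ?cabs_ge0 //.
by rewrite sqr_cabs /= cos2Dsin2 expr1n.
Qed.

Lemma expi_2pi_int n : expi (2 * pi * n%:~R : R) = 1.
Proof.
have nat_case (k : nat) : expi (2 * pi * k%:R : R) = 1.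
  elim: k => [|k ih]; first by rewrite mulr0 expi0.
  rewrite -(natr1 k) mulrDr mulr1 expiD ih mul1r /expi.
  by rewrite mulr_natl cos2pi sin2pi.
case: n => k; first exact: nat_case.
by rewrite NegzE mulrNz mulrN expiN nat_case conjc1.
Qed.

Definition mode n t : R[i] := expi (2 * pi * n%:~R * t).

Lemma modeD n n' t : mode (n + n') t = mode n t * mode n' t.
Proof. by rewrite -expiD /mode; congr expi; rewrite intrD; ring. Qed.

Lemma modeN n t : mode (- n) t = conjc (mode n t).
Proof. by rewrite -expiN /mode mulrNz mulrN mulNr. Qed.

Lemma mode0 t : mode 0 t = 1.
Proof. by rewrite /mode mulr0 mul0r expi0. Qed.

(** Only an interval containing the frequencies is recorded, not the coefficients: a mean vanishes
    as soon as the interval misses 0, and under products the endpoints simply add. *)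
Inductive spectrum (lo hi : int) : (R -> R[i]) -> Prop :=
| spectrum0 : spectrum lo hi (fun=> 0)
| spectrum_cons (c : R[i]) n f : lo <= n <= hi -> spectrum lo hi f ->
    spectrum lo hi (fun t => c * mode n t + f t).

Lemma spectrum_ext lo hi f g : f =1 g -> spectrum lo hi f -> spectrum lo hi g.
Proof. by move=> /funext ->. Qed.

Lemma spectrum_mode lo hi (c : R[i]) n : lo <= n <= hi ->
  spectrum lo hi (fun t => c * mode n t).
Proof.
move=> h; apply: spectrum_ext (spectrum_cons c h (spectrum0 _ _)) => t.
by rewrite addr0.
Qed.

Lemma spectrum_cst (c : R[i]) : spectrum 0 0 (fun=> c).
Proof.
by apply: spectrum_ext (@spectrum_mode 0 0 c 0 _) => // t; rewrite mode0 mulr1.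
Qed.

Lemma spectrumW lo hi lo' hi' f : lo' <= lo -> hi <= hi' ->
  spectrum lo hi f -> spectrum lo' hi' f.
Proof.
move=> hlo hhi; elim=> [|c n g /andP[h1 h2] _ ih]; first exact: spectrum0.
by apply: spectrum_cons => //; rewrite (le_trans hlo) // (le_trans h2).
Qed.

Lemma spectrumD lo hi f g : spectrum lo hi f -> spectrum lo hi g ->
  spectrum lo hi (fun t => f t + g t).
Proof.
move=> hf hg; elim: hf => [|c n f' hn _ ih].
  by apply: spectrum_ext hg => t; rewrite add0r.
by apply: spectrum_ext (spectrum_cons c hn ih) => t; rewrite addrA.
Qed.

Lemma spectrum_mul_mode lo hi f (c : R[i]) n : spectrum lo hi f ->
  spectrum (lo + n) (hi + n) (fun t => f t * (c * mode n t)).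
Proof.
elim=> [|c' n' g hn _ ih].
  by apply: spectrum_ext (spectrum0 _ _) => t; rewrite mul0r.
apply: spectrum_ext (@spectrum_cons _ _ (c' * c) (n' + n) _ _ ih).
  by move=> t; rewrite modeD; ring.
by rewrite !lerD2r.
Qed.

Lemma spectrum_scale lo hi f (c : R[i]) : spectrum lo hi f ->
  spectrum lo hi (fun t => f t * c).
Proof.
move=> hf; have := spectrum_mul_mode c 0 hf; rewrite !addr0.
by apply: spectrum_ext => t; rewrite mode0 mulr1.
Qed.

Lemma spectrumM lo hi lo' hi' f g : spectrum lo hi f -> spectrum lo' hi' g ->
  spectrum (lo + lo') (hi + hi') (fun t => f t * g t).
Proof.
move=> hf; elim=> [|c n g' /andP[h1 h2] _ ih].
  by apply: spectrum_ext (spectrum0 _ _) => t; rewrite mulr0.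
have := spectrum_mul_mode c n hf => /(spectrumW (lo' := lo + lo') (hi' := hi + hi')).
rewrite !lerD2l => /(_ h1 h2) h; apply: spectrum_ext (spectrumD h ih) => t.
by rewrite mulrDr.
Qed.

Lemma spectrum_conjc lo hi f : spectrum lo hi f ->
  spectrum (- hi) (- lo) (fun t => conjc (f t)).
Proof.
elim=> [|c n g /andP[h1 h2] _ ih].
  by apply: spectrum_ext (spectrum0 _ _) => t; rewrite conjc0.
apply: spectrum_ext (@spectrum_cons _ _ (conjc c) (- n) _ _ ih).
  by move=> t; rewrite conjcD conjcM modeN.
by rewrite !lerN2 h1 h2.
Qed.

Lemma Re_mode (c : R[i]) n t : complex.Re (c * mode n t) =
  complex.Re c * cos (2 * pi * n%:~R * t) - complex.Im c * sin (2 * pi * n%:~R * t).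
Proof. by case: c. Qed.

Lemma Im_mode (c : R[i]) n t : complex.Im (c * mode n t) =
  complex.Re c * sin (2 * pi * n%:~R * t) + complex.Im c * cos (2 * pi * n%:~R * t).
Proof. by case: c. Qed.

Lemma continuous_add (u v : R -> R) : continuous u -> continuous v ->
  continuous (fun t => u t + v t).
Proof. by move=> cu cv t; apply: cvgD; [exact: cu|exact: cv]. Qed.

Lemma continuous_scale (c : R) (u : R -> R) : continuous u ->
  continuous (fun t => c * u t).
Proof. by move=> cu t; apply: cvgM; [exact: cvg_cst|exact: cu]. Qed.

Lemma continuous_sinZ (w : R) : continuous (fun t => sin (w * t)).
Proof.
move=> t; apply: continuous_comp; last exact: continuous_sin.
by apply: (@continuous_scale w id) => s; exact: cvg_id.
Qed.

Lemma continuous_cosZ (w : R) : continuous (fun t => cos (w * t)).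
Proof.
move=> t; apply: continuous_comp; last exact: continuous_cos.
by apply: (@continuous_scale w id) => s; exact: cvg_id.
Qed.

Lemma spectrum_continuous_Re lo hi f : spectrum lo hi f ->
  continuous (fun t => complex.Re (f t)).
Proof.
elim=> [|c n g _ _ ih]; first by move=> t; exact: cst_continuous.
rewrite (_ : (fun _ => _) = fun t => complex.Re c * cos (2 * pi * n%:~R * t)
  + (- complex.Im c) * sin (2 * pi * n%:~R * t) + complex.Re (g t)); last first.
  by apply/funext => s; rewrite Re_add Re_mode mulNr.
apply: continuous_add => //; apply: continuous_add; apply: continuous_scale.
  exact: continuous_cosZ.
exact: continuous_sinZ.
Qed.

Lemma spectrum_continuous_Im lo hi f : spectrum lo hi f ->
  continuous (fun t => complex.Im (f t)).
Proof.
elim=> [|c n g _ _ ih]; first by move=> t; exact: cst_continuous.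
rewrite (_ : (fun _ => _) = fun t => complex.Re c * sin (2 * pi * n%:~R * t)
  + complex.Im c * cos (2 * pi * n%:~R * t) + complex.Im (g t)); last first.
  by apply/funext => s; rewrite Im_add Im_mode.
apply: continuous_add => //; apply: continuous_add; apply: continuous_scale.
  exact: continuous_sinZ.
exact: continuous_cosZ.
Qed.

Local Notation mu := (@lebesgue_measure R).
Local Notation T := (@torus R).

Lemma measurable_torus : measurable T.
Proof. exact: measurable_itv. Qed.

Lemma mu_torus : mu T = 1%E.
Proof. by rewrite /torus lebesgue_measure_itv /= lte_fin ltr01 sube0. Qed.

Lemma Rintegral_torus_cst (c : R) : \int[mu]_(t in T) c = c.
Proof.
rewrite /Rintegral [X in fine X](integral_cst mu measurable_torus c%:E).
by rewrite [X in (_ * X)%E]mu_torus mule1.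
Qed.

Lemma continuous_torus_integrable (f : R -> R) : continuous f ->
  mu.-integrable T (EFin \o f).
Proof.
move=> cf; apply: continuous_compact_integrable; first exact: segment_compact.
exact: continuous_subspaceT.
Qed.

Lemma Rintegral_Re_mode (c : R[i]) n : n != 0 ->
  \int[mu]_(t in T) complex.Re (c * mode n t) = 0.
Proof.
move=> n0; set w : R := 2 * pi * n%:~R.
have w0 : w != 0.
  by rewrite !mulf_neq0 ?pnatr_eq0 ?intr_eq0 // gt_eqF // pi_gt0.
pose F t := (complex.Re c / w) * sin (w * t) + (complex.Im c / w) * cos (w * t).
have dF t : is_derive t 1 F (complex.Re (c * mode n t)).
  rewrite /F Re_mode -/w.
  have dm : is_derive t (1 : R) (fun t => w * t) w.
    by apply: is_derive_eq; rewrite /GRing.scale /= mulr1.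
  have ds := is_derive1_comp (is_derive_sin (w * t)) dm.
  have dc := is_derive1_comp (is_derive_cos (w * t)) dm.
  have := is_deriveD (is_deriveZ (complex.Re c / w) ds) (is_deriveZ (complex.Im c / w) dc).
  by move/is_derive_eq; apply; rewrite /GRing.scale /=; field; exact: w0.
rewrite /Rintegral (@continuous_FTC2 _ _ F).
- rewrite /F mulr1 mulr0 sin0 cos0.
  have [->->] : cos w = 1 /\ sin w = 0.
    by have := expi_2pi_int n; rewrite -/w => /eqP; rewrite eq_complex => /andP[/eqP ? /eqP].
  by rewrite subee.
- exact: ltr01.
- apply: continuous_subspaceT.
  by apply: (@spectrum_continuous_Re n n); apply: spectrum_mode; rewrite lexx.
- have cF : continuous F.
    by move=> t; apply: differentiable_continuous; apply/derivable1_diffP; exact: ex_derive.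
  split=> [t _||]; first exact: ex_derive.
  + exact: cvg_at_right_filter (cF 0).
  + exact: cvg_at_left_filter (cF 1).
- by move=> t _; rewrite derive1E derive_val.
Qed.

Lemma spectrum_Rintegral_Re lo hi f : spectrum lo hi f -> 0 < lo \/ hi < 0 ->
  \int[mu]_(t in T) complex.Re (f t) = 0.
Proof.
move=> + h; elim=> [|c n g /andP[h1 h2] hg ih].
  exact: Rintegral_torus_cst.
under eq_Rintegral do rewrite Re_add.
rewrite RintegralD ?ih ?Rintegral_Re_mode ?addr0 //.
- case: h => h; first by rewrite gt_eqF // (lt_le_trans h).
  by rewrite lt_eqF // (le_lt_trans h2).
- exact: measurable_torus.
- apply: continuous_torus_integrable; apply: (@spectrum_continuous_Re n n).
  by by apply: spectrum_mode; rewrite lexx.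
- exact: continuous_torus_integrable (spectrum_continuous_Re hg).
Qed.

End TrigonometricPolynomials.

(** * Blocks of the lacunary product: frequencies, first and second moments *)

Section LacunaryBlocks.
Variables (R : realType) (m : nat -> nat) (A : nat -> R) (B : nat -> R[i]).
Hypothesis m_gt0 : forall j, (0 < m j)%N.
Hypothesis m_lac : forall j, (2 * m j <= m j.+1)%N.
Hypothesis A_gt0 : forall j, 0 < A j.
Hypothesis AB1 : forall j, A j ^+ 2 - cabs (B j) ^+ 2 = 1.
Implicit Types (t : R) (M N j : nat).

Local Notation mu := (@lebesgue_measure R).
Local Notation T := (@torus R).

Definition S2 j : R := A j ^+ 2 + cabs (B j) ^+ 2.

Lemma factorE j t : Defs.factor (A j) (B j) (m j) t =
  conj_mx2 ((A j)%:C)%C (B j * mode (m j)%:Z t).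
Proof. by rewrite /Defs.factor /conj_mx2 conjcM expiN conjc_real. Qed.

Lemma SU11_factor j t : SU11 (Defs.factor (A j) (B j) (m j) t).
Proof.
rewrite factorE; apply: SU11_conj_mx2.
by rewrite cabsM cabs_expi mulr1 cabs_real // ltW.
Qed.

Definition block M N t : 'M[R[i]]_2 :=
  \prod_(M <= j < N) Defs.factor (A j) (B j) (m j) t.

Lemma gN_block N t : gN A B m N t = block 0 N t.
Proof. by rewrite /gN /block big_mkord. Qed.

Lemma block_nil M t : block M M t = 1%:M.
Proof. by rewrite /block big_geq. Qed.

Lemma block_recr M N t : (M <= N)%N ->
  block M N.+1 t = block M N t *m Defs.factor (A N) (B N) (m N) t.
Proof. by move=> MN; rewrite /block big_nat_recr. Qed.

Lemma block_cat M N K t : (M <= N)%N -> (N <= K)%N ->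
  block M K t = block M N t *m block N K t.
Proof. by move=> MN NK; rewrite /block (big_cat_nat MN NK). Qed.

Lemma SU11_block M N t : SU11 (block M N t).
Proof.
rewrite /block; elim/big_ind: _ => [|G H hG hH|j _]; first exact: SU11_1.
  exact: SU11_mul.
exact: SU11_factor.
Qed.

(** Left invariance in action: the distance between two partial products becomes the distance of a
    block from the identity. *)
Lemma blockV_cat M N t : (M <= N)%N ->
  invmx (block 0 M t) *m block 0 N t = block M N t.
Proof.
move=> MN; rewrite (@block_cat 0 M N) // mulmxA mulVmx ?mul1mx //.
exact/SU11_unit/SU11_block.
Qed.

Lemma block00_recr M N t : (M <= N)%N -> block M N.+1 t 0 0 =
  block M N t 0 0 * ((A N)%:C)%C + block M N t 0 1 * (conjc (B N) * mode (- (m N)%:Z) t).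
Proof.
move=> MN; rewrite block_recr // factorE; have /SU11P [-> _] := SU11_block M N t.
by rewrite conj_mx2M !mx2E modeN conjcM.
Qed.

Lemma block01_recr M N t : (M <= N)%N -> block M N.+1 t 0 1 =
  block M N t 0 0 * (B N * mode (m N)%:Z t) + block M N t 0 1 * ((A N)%:C)%C.
Proof.
move=> MN; rewrite block_recr // factorE; have /SU11P [-> _] := SU11_block M N t.
by rewrite conj_mx2M !mx2E conjc_real.
Qed.

(* Multiplying out the product, the frequencies of the diagonal entry are the
   alternating sums [m_j1 - m_j2 + ... - m_j2k] and those of the off-diagonal
   one are [m_j1 - m_j2 + ... + m_j(2k+1)], over increasing indices. *)
Lemma block_spectrum M N : (M <= N)%N ->
  spectrum (1 - (m N)%:Z) 0 (fun t => block M N.+1 t 0 0) /\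
  spectrum 1 (m N)%:Z (fun t => block M N.+1 t 0 1).
Proof.
move=> /subnKC <-; elim: (N - M)%N => [|k [iha ihb]]; rewrite ?addn0 ?addnS.
  have m0 := m_gt0 M; split.
    apply: (spectrum_ext (f := fun=> ((A M)%:C)%C)).
      by move=> t; rewrite block00_recr // block_nil !mxE /= mul1r mul0r addr0.
    by apply: spectrumW (spectrum_cst _); lia.
  apply: (spectrum_ext (f := fun t => B M * mode (m M)%:Z t)).
    by move=> t; rewrite block01_recr // block_nil !mxE /= mul1r mul0r addr0.
  by apply: spectrum_mode; lia.
set N' := (M + k)%N in iha ihb *.
have MN : (M <= N'.+1)%N by rewrite leqW // leq_addr.
have := m_lac N'; have := m_gt0 N' => m0 m2.
split.
  apply: (spectrum_ext (fun t => esym (block00_recr t MN))).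
  apply: spectrumD; first by apply: spectrumW (spectrum_scale _ iha); lia.
  by apply: spectrumW (spectrum_mul_mode _ _ ihb); lia.
apply: (spectrum_ext (fun t => esym (block01_recr t MN))).
apply: spectrumD; last by apply: spectrumW (spectrum_scale _ ihb); lia.
by apply: spectrumW (spectrum_mul_mode _ _ iha); lia.
Qed.

Lemma block_continuous M N : (M <= N)%N ->
  [/\ continuous (fun t => complex.Re (block M N t 0 0)),
      continuous (fun t => complex.Im (block M N t 0 0)),
      continuous (fun t => complex.Re (block M N t 0 1)) &
      continuous (fun t => complex.Im (block M N t 0 1))].
Proof.
rewrite leq_eqVlt => /predU1P[<-|].
  have E (f : 'M[R[i]]_2 -> R) : continuous (fun t => f (block M M t)).
    by under eq_fun do rewrite block_nil; move=> t; exact: cst_continuous.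
  by split; [apply: (E (fun G => complex.Re (G 0 0)))
            |apply: (E (fun G => complex.Im (G 0 0)))
            |apply: (E (fun G => complex.Re (G 0 1)))
            |apply: (E (fun G => complex.Im (G 0 1)))].
case: N => // N; rewrite ltnS => MN; have [ha hb] := block_spectrum MN; split.
- exact: spectrum_continuous_Re ha.
- exact: spectrum_continuous_Im ha.
- exact: spectrum_continuous_Re hb.
- exact: spectrum_continuous_Im hb.
Qed.

Lemma continuous_mul (u v : R -> R) : continuous u -> continuous v ->
  continuous (fun t => u t * v t).
Proof. by move=> cu cv t; apply: cvgM; [exact: cu|exact: cv]. Qed.

Definition energy (G : 'M[R[i]]_2) : R := cabs (G 0 0) ^+ 2 + cabs (G 0 1) ^+ 2.

(** For [G] in SU(1,1), half the squared Hilbert-Schmidt norm of [G - 1]. It is comparable with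
    [dist1 G ^+ 2], but quadratic in the entries, so its mean can be computed. *)
Definition energy1 (G : 'M[R[i]]_2) : R :=
  cabs (G 0 0 - 1) ^+ 2 + cabs (G 0 1) ^+ 2.

Lemma energy1E G : energy1 G = energy G + (1 - 2 * complex.Re (G 0 0)).
Proof.
rewrite /energy1 /energy !sqr_cabs; case: (G 0 0) => x y /=; rewrite oppr0 addr0.
ring.
Qed.

Lemma continuous_energy M N : (M <= N)%N ->
  continuous (fun t => energy (block M N t)).
Proof.
move=> /block_continuous [c1 c2 c3 c4].
under eq_fun do rewrite /energy !sqr_cabs !expr2.
by do !apply: continuous_add; apply: continuous_mul.
Qed.

(** The ratio 2 enters here. If [m_n] is the last frequency of the block, [a * conj b] has
    frequencies from 1 - 2 m_n to -1; shifted by the next frequency they start at 1 - 2 m_n +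
    m_(n+1), which is at least 1. For an empty block, b = 0 and both products vanish. *)
Lemma block_cross_spectrum M N (c : R[i]) : (M <= N)%N ->
  (exists lo, spectrum lo (-1)
     (fun t => block M N t 0 1 * (c * mode (- (m N)%:Z) t))) /\
  (exists hi, spectrum 1 hi
     (fun t => block M N t 0 0 * conjc (block M N t 0 1) * (c * mode (m N)%:Z t))).
Proof.
rewrite leq_eqVlt => /predU1P[<-|].
  split; [exists (-1)|exists 1]; apply: spectrum_ext (@spectrum0 _ _ _) => t;
    by rewrite block_nil conj_mx2_1 !mx2E ?conjc0 ?mulr0 ?mul0r.
case: N => // N; rewrite ltnS => MN; have [ha hb] := block_spectrum MN.
have := m_lac N; have := m_gt0 N => m0 m2; split.
  exists (1 - (m N.+1)%:Z); apply: spectrumW (spectrum_mul_mode _ _ hb); lia.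
have := spectrum_mul_mode c (m N.+1)%:Z (spectrumM ha (spectrum_conjc hb)).
by set hi := (X in spectrum _ X _) => h; exists hi; apply: spectrumW h; lia.
Qed.

(** A further factor multiplies a by A_N and adds a term with strictly negative frequencies, which
    has mean zero. *)
Lemma Rintegral_block00 M N : (M <= N)%N ->
  \int[mu]_(t in T) complex.Re (block M N t 0 0) = \prod_(M <= j < N) A j.
Proof.
move=> /subnKC <-; elim: (N - M)%N => [|k ih]; rewrite ?addn0 ?addnS.
  under eq_Rintegral do rewrite block_nil mxE /=.
  by rewrite big_geq // Rintegral_torus_cst.
set N' := (M + k)%N in ih *; have MN : (M <= N')%N by rewrite leq_addr.
have [ca _ _ _] := block_continuous MN.
have [[lo hlo] _] := block_cross_spectrum (conjc (B N')) MN.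
have Emul t : complex.Re (block M N' t 0 0 * ((A N')%:C)%C) =
    complex.Re (block M N' t 0 0) * A N'.
  by case: (block M N' t 0 0) => x y /=; rewrite mulr0 subr0.
under eq_Rintegral do rewrite block00_recr // Re_add Emul.
rewrite big_nat_recr //= -ih RintegralD.
- rewrite (spectrum_Rintegral_Re hlo) ?addr0; last by right.
  rewrite RintegralZr //; first exact: measurable_torus.
  exact: continuous_torus_integrable.
- exact: measurable_torus.
- apply: continuous_torus_integrable; apply: continuous_mul => // t.
  exact: cst_continuous.
- exact: continuous_torus_integrable (spectrum_continuous_Re hlo).
Qed.

(** Both squared moduli produce the same cross term 2 A Re(a conj(b) w), whence the factor 4; the
    remaining terms factor as a product of two energies. *)
Lemma energy_recr M N t : (M <= N)%N -> energy (block M N.+1 t) =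
  energy (block M N t) * S2 N + 4 * A N * complex.Re
    (block M N t 0 0 * conjc (block M N t 0 1) * (B N * mode (m N)%:Z t)).
Proof.
move=> MN; rewrite /energy block00_recr // block01_recr //.
rewrite modeN -conjcM /S2.
have -> : cabs (B N) ^+ 2 = cabs (B N * mode (m N)%:Z t) ^+ 2.
  by rewrite cabsM cabs_expi mulr1.
move: (block M N t 0 0) (block M N t 0 1) (B N * _) => [a1 a2] [b1 b2] [w1 w2].
by rewrite !sqr_cabs /=; ring.
Qed.

Lemma Rintegral_energy M N : (M <= N)%N ->
  \int[mu]_(t in T) energy (block M N t) = \prod_(M <= j < N) S2 j.
Proof.
move=> /subnKC <-; elim: (N - M)%N => [|k ih]; rewrite ?addn0 ?addnS.
  under eq_Rintegral do rewrite block_nil /energy conj_mx2_1 !mx2E cabs0 cabs1 expr1n expr0n addr0.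
  by rewrite big_geq // Rintegral_torus_cst.
set N' := (M + k)%N in ih *; have MN : (M <= N')%N by rewrite leq_addr.
have ce := continuous_energy MN.
have [_ [hi hhi]] := block_cross_spectrum (B N') MN.
have chi := spectrum_continuous_Re hhi.
under eq_Rintegral do rewrite energy_recr //.
rewrite big_nat_recr //= -ih RintegralD.
- rewrite RintegralZl; last 2 first.
  + exact: measurable_torus.
  + exact: continuous_torus_integrable.
  rewrite (spectrum_Rintegral_Re hhi) ?mulr0 ?addr0; last by left.
  rewrite RintegralZr //; first exact: measurable_torus.
  exact: continuous_torus_integrable.
- exact: measurable_torus.
- apply: continuous_torus_integrable; apply: continuous_mul => // t.
  exact: cst_continuous.
- apply: continuous_torus_integrable; exact: continuous_scale.
Qed.

Lemma continuous_energy1 M N : (M <= N)%N ->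
  continuous (fun t => energy1 (block M N t)).
Proof.
move=> MN; have [ca _ _ _] := block_continuous MN.
under eq_fun do rewrite energy1E.
apply: continuous_add; first exact: continuous_energy.
apply: (@continuous_add _ (fun=> 1)); first by move=> t; exact: cst_continuous.
by under eq_fun do rewrite -mulNr; exact: continuous_scale.
Qed.

Lemma Rintegral_energy1 M N : (M <= N)%N ->
  \int[mu]_(t in T) energy1 (block M N t) =
  \prod_(M <= j < N) S2 j + 1 - 2 * \prod_(M <= j < N) A j.
Proof.
move=> MN; have [ca _ _ _] := block_continuous MN.
have mT := @measurable_torus R.
have c1 : continuous ((fun=> 1) : R -> R) by move=> t; exact: cst_continuous.
have i1 := continuous_torus_integrable c1.
have i2 := continuous_torus_integrable (@continuous_scale _ (-2) _ ca).
under eq_Rintegral do rewrite energy1E -mulNr.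
rewrite RintegralD //; last 2 first.
- exact/continuous_torus_integrable/continuous_energy.
- exact: continuous_torus_integrable (continuous_add c1 (@continuous_scale _ (-2) _ ca)).
rewrite [X in _ + X = _]RintegralD // RintegralZl //; last exact: continuous_torus_integrable.
rewrite Rintegral_energy // Rintegral_block00 // Rintegral_torus_cst.
ring.
Qed.

Lemma A_ge1 j : 1 <= A j.
Proof.
rewrite -(ler_pXn2r (n := 2)) ?nnegrE ?ler01 // ?(ltW (A_gt0 j)) //.
rewrite expr1n; have := AB1 j; have := sqr_ge0 (cabs (B j)); lra.
Qed.

Lemma S2_ge1 j : 1 <= S2 j.
Proof. by rewrite /S2; have := AB1 j; have := sqr_ge0 (cabs (B j)); lra. Qed.

Lemma S2E j : S2 j = 2 * A j ^+ 2 - 1.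
Proof. by rewrite /S2; have := AB1 j; lra. Qed.

Definition sumlnS2 M N : R := \sum_(M <= j < N) ln (S2 j).

Lemma lnS2_ge0 M N : 0 <= sumlnS2 M N.
Proof. by apply: sumr_ge0 => j _; rewrite ln_ge0 // S2_ge1. Qed.

Lemma prod_S2 M N : \prod_(M <= j < N) S2 j = expR (sumlnS2 M N).
Proof.
rewrite /sumlnS2 expR_sum; apply: eq_bigr => j _; rewrite lnK // posrE.
exact: lt_le_trans (S2_ge1 j).
Qed.

Lemma prod_A_ge1 M N : 1 <= \prod_(M <= j < N) A j.
Proof.
elim/big_ind: _ => // [x y x1 y1|j _]; last exact: A_ge1.
by rewrite -(mulr1 1) ler_pM.
Qed.

(* AM-GM: [A j ^+ 2 = (1 + S2 j) / 2] is at least the square root of [S2 j]. *)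
Lemma prod_A_ge M N : expR (sumlnS2 M N / 4) <= \prod_(M <= j < N) A j.
Proof.
rewrite /sumlnS2 mulr_suml expR_sum; apply: ler_prod => j _; rewrite expR_ge0 /=.
rewrite -(ler_pXn2r (n := 4)) ?nnegrE ?expR_ge0 ?(ltW (A_gt0 j)) //.
have S0 : 0 < S2 j by exact: lt_le_trans (S2_ge1 j).
rewrite -expRM_natl -mulr_natl mulrCA divff ?pnatr_eq0 // mulr1 lnK ?posrE //.
rewrite S2E -subr_ge0 (_ : _ - _ = (A j ^+ 2 - 1) ^+ 2) ?sqr_ge0 //; ring.
Qed.

End LacunaryBlocks.

(** * Scalar inequalities relating powers of the logarithm to quadratic functions *)

Section LogInequalities.
Variable R : realType.

(** With d = e^(1/p): for x <= d the bound ln(1+x) <= x already gives e. For x > d, ln(1+x) <=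
    (p/2)(1+x)^(2/p) turns the p-th power into a multiple of (1+x)^2, and 1 + x <= (1/d + 1) x. *)
Lemma ln1p_powR_upper (p e : R) : 0 < p -> 0 < e -> exists C : R, 0 <= C /\
  forall x : R, 0 <= x -> (ln (1 + x)) `^ p <= e + C * x ^+ 2.
Proof.
move=> p0 e0; pose d := e `^ p^-1; have d0 : 0 < d by exact: powR_gt0.
have p2 : 0 < p / 2 by rewrite divr_gt0.
exists ((p / 2) `^ p * (d^-1 + 1) ^+ 2); split.
  by rewrite mulr_ge0 ?powR_ge0 ?sqr_ge0.
move=> x x0; have x1 : 0 < 1 + x by rewrite ltr_pwDl.
have l0 : 0 <= ln (1 + x) by rewrite ln_ge0 // lerDl.
have C0 : 0 <= (p / 2) `^ p * (d^-1 + 1) ^+ 2 * x ^+ 2.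
  by apply: mulr_ge0 (sqr_ge0 _); apply: mulr_ge0 (powR_ge0 _ _) (sqr_ge0 _).
have [xd|dx] := leP x d.
  apply: le_trans (_ : e <= _); last by rewrite lerDl.
  have -> : e = d `^ p by rewrite -powRrM mulVf ?gt_eqF // powRr1 // ltW.
  apply: ge0_ler_powR; rewrite ?nnegrE ?(ltW p0) ?(ltW d0) //.
  by apply: le_trans xd; apply: le_ln1Dx; rewrite (lt_le_trans _ x0) ?ltrN10.
apply: le_trans (_ : (p / 2) `^ p * (1 + x) ^+ 2 <= _); last first.
  apply: le_trans (_ : (p / 2) `^ p * (d^-1 + 1) ^+ 2 * x ^+ 2 <= _).
    rewrite -mulrA -exprMn ler_wpM2l ?powR_ge0 // ler_pXn2r ?nnegrE ?(ltW x1) //; last first.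
      by rewrite mulr_ge0 // addr_ge0 // invr_ge0 ltW.
    by rewrite mulrDl mul1r lerD2r mulrC ler_pdivlMr // mul1r ltW.
  by rewrite lerDr ltW.
have -> : (1 + x) ^+ 2 = ((1 + x) `^ (2 / p)) `^ p.
  by rewrite -powRrM divfK ?gt_eqF // powR_mulrn // ltW.
rewrite -powRM ?powR_ge0 ?(ltW p2) //.
apply: ge0_ler_powR; rewrite ?nnegrE // ?mulr_ge0 ?powR_ge0 // ?(ltW p2) ?(ltW p0) //.
have -> : ln (1 + x) = p / 2 * ln ((1 + x) `^ (2 / p)).
  by rewrite ln_powR mulrA (_ : p / 2 * _ = 1) ?mul1r //; field; rewrite gt_eqF.
by rewrite ler_pM2l // ltW // ln_sublinear // powR_gt0.
Qed.

(* A Paley-Zygmund inequality in pointwise form. *)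
Lemma ln1p_powR_lower (p c K : R) : 0 < p -> 0 < c -> 0 < K -> exists D : R, 0 < D /\
  forall y : R, 0 <= y -> y <= c / 4 + c / (4 * K) * y ^+ 2 + D * (ln (1 + y)) `^ p.
Proof.
(* Three ranges of y, one for each term: up to [c / 4] the constant suffices; beyond [L] the
   quadratic term does, because its coefficient is 1/L; in between, the logarithmic factor is at
   least [k], so [D = L / k] works. *)
move=> p0 c0 K0; pose L := 4 * K / c; pose k := (ln (1 + c / 4)) `^ p.
have L0 : 0 < L by rewrite divr_gt0 // mulr_gt0.
have c4 : 0 < c / 4 by rewrite divr_gt0.
have lc : 0 < ln (1 + c / 4) by rewrite ln_gt0 // ltrDl.
have k0 : 0 < k by exact: powR_gt0.
have cK : c / (4 * K) = L^-1 by rewrite /L invf_div.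
exists (L / k); split; first exact: divr_gt0.
move=> y y0; rewrite cK.
have h1 : 0 <= L^-1 * y ^+ 2 by rewrite mulr_ge0 ?sqr_ge0 // invr_ge0 ltW.
have h2 : 0 <= L / k * (ln (1 + y)) `^ p.
  by rewrite mulr_ge0 ?powR_ge0 // divr_ge0 // ltW.
have [yc|cy] := leP y (c / 4); first lra.
have [yL|Ly] := leP y L.
  suff : y <= L / k * (ln (1 + y)) `^ p by lra.
  apply: le_trans yL _; rewrite mulrAC ler_pdivlMr // ler_pM2l //.
  have l1 : ln (1 + c / 4) <= ln (1 + y).
    by rewrite ler_ln ?posrE ?ltr_pwDl ?(ltW c4) // lerD2l ltW.
  apply: ge0_ler_powR; rewrite ?nnegrE ?(ltW p0) ?(ltW lc) //.
  exact: le_trans (ltW lc) l1.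
suff : y <= L^-1 * y ^+ 2 by lra.
by rewrite mulrC ler_pdivlMr // expr2 ler_wpM2l // ltW.
Qed.

(** A substitute for Minkowski's inequality covering p < 1 and p >= 1 together: x + y is at most
    twice the larger term. *)
Lemma powRD_le (p x y : R) : 0 < p -> 0 <= x -> 0 <= y ->
  (x + y) `^ p <= 2 `^ p * (x `^ p + y `^ p).
Proof.
move=> p0 x0 y0; wlog xy : x y x0 y0 / x <= y.
  move=> h; have [|/ltW] := leP x y; first exact: h.
  by rewrite addrC [x `^ p + _]addrC; exact: h.
apply: le_trans (_ : 2 `^ p * y `^ p <= _); last first.
  by rewrite ler_wpM2l ?powR_ge0 // lerDr powR_ge0.
rewrite -powRM //; apply: ge0_ler_powR; rewrite ?nnegrE ?(ltW p0) ?addr_ge0 ?mulr_ge0 //.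
by rewrite mulr_natl mulr2n lerD2r.
Qed.

End LogInequalities.

(** * Convergence in [dp] expressed through [rho_int] *)

Section Convergence.
Variable R : realType.

Lemma cvge0P (u : nat -> \bar R) : (forall n, 0 <= u n)%E ->
  (u @ \oo --> 0%E) <->
  (forall d : R, 0 < d -> exists N, forall n, (N <= n)%N -> (u n <= d%:E)%E).
Proof.
move=> u0; split=> [/fine_cvgP [[N0 _ fu] /cvgrPdist_lt cu] d d0|h].
  have [N1 _ hN1] := cu d d0; exists (maxn N0 N1) => n.
  rewrite geq_max => /andP[n0 n1]; have fun_ := fu n n0.
  rewrite -(fineK fun_) lee_fin ltW //; have := hN1 n n1.
  by rewrite /= sub0r normrN ger0_norm // fine_ge0.
apply/fine_cvgP; split.
  have [N hN] := h 1 ltr01; exists N => // n /= Nn.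
  by rewrite ge0_fin_numE // (le_lt_trans (hN n Nn)) ?ltry.
apply/cvgrPdist_lt => d d0; have [N hN] := h (d / 2) (divr_gt0 d0 (ltr0n _ 2)).
exists N => // n /= Nn; have un := hN n Nn.
have fu : u n \is a fin_num by rewrite ge0_fin_numE // (le_lt_trans un) ?ltry.
rewrite sub0r normrN ger0_norm ?fine_ge0 //.
have : fine (u n) <= d / 2 by rewrite -lee_fin fineK.
by move=> /le_lt_trans; apply; rewrite ltr_pdivrMr // ltr_pMr // ltr1n.
Qed.

Implicit Types (g h : R -> 'M[R[i]]_2) (u : nat -> R -> 'M[R[i]]_2).

Lemma rho_int_ge0 (p : R) g h : (0 <= rho_int p g h)%E.
Proof. by apply: integral_ge0 => t _; rewrite lee_fin powR_ge0. Qed.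

Lemma dp_ge0 (p : R) g h : (0 <= dp p g h)%E.
Proof. by rewrite /dp; case: ifP => _; rewrite ?poweR_ge0 ?rho_int_ge0. Qed.

Lemma dp_lty (p : R) g h : (rho_int p g h < +oo)%E -> (dp p g h < +oo)%E.
Proof. by rewrite /dp; case: ifP => // _; exact: poweR_lty. Qed.

Lemma poweR_le (r : R) (x y : \bar R) : 0 <= r -> (0 <= x)%E -> (x <= y)%E ->
  (x `^ r <= y `^ r)%E.
Proof.
move=> r0 x0 xy; apply: gt0_ler_poweR => //; rewrite in_itv /= leey andbT //.
exact: le_trans xy.
Qed.

(** Taking the root of order p or not does not affect convergence to 0, so the two cases in the
    definition of [dp] need not be separated any further. *)
Lemma dp_cvg0P (p : R) u g : 0 < p -> (fun N => dp p (u N) g) @ \oo --> 0%E <->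
  (forall d : R, 0 < d ->
     exists N, forall n, (N <= n)%N -> (rho_int p (u n) g <= d%:E)%E).
Proof.
move=> p0; apply: (iff_trans (cvge0P (fun n => dp_ge0 p (u n) g))).
rewrite /dp; case: (1 <= p); last by [].
split=> h d d0.
  have [N hN] := h (d `^ p^-1) (powR_gt0 _ d0); exists N => n /hN.
  move=> /(poweR_le (ltW p0) (poweR_ge0 _ _)).
  by rewrite -poweRrM mulVf ?gt_eqF // poweRe1 ?rho_int_ge0 // poweR_EFin -powRrM
    mulVf ?gt_eqF // powRr1 // ltW.
have [N hN] := h (d `^ p) (powR_gt0 _ d0); exists N => n /hN.
have p0' : 0 <= p^-1 by rewrite invr_ge0 ltW.
move=> /(poweR_le p0' (rho_int_ge0 _ _ _)).
by rewrite poweR_EFin -powRrM mulfV ?gt_eqF // powRr1 // ltW.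
Qed.

End Convergence.

(** * Measurability of quotients, of [dist1] and of [rho] *)

Section Measurability.
Variable R : realType.
Implicit Types (g h : R -> 'M[R[i]]_2).

Local Notation mu := (@lebesgue_measure R).
Local Notation T := (@torus R).

Definition cmeasurable (f : R -> R[i]) :=
  measurable_fun T (fun t => complex.Re (f t)) /\
  measurable_fun T (fun t => complex.Im (f t)).

Lemma cmeasurable_cst (c : R[i]) : cmeasurable (fun=> c).
Proof. by split; exact: measurable_cst. Qed.

Lemma cmeasurableD (f1 f2 : R -> R[i]) : cmeasurable f1 -> cmeasurable f2 ->
  cmeasurable (fun t => f1 t + f2 t).
Proof.
move=> [r1 i1] [r2 i2]; split.
  by under eq_fun do rewrite Re_add; exact: measurable_funD.
by under eq_fun do rewrite Im_add; exact: measurable_funD.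
Qed.

Lemma cmeasurableM (f1 f2 : R -> R[i]) : cmeasurable f1 -> cmeasurable f2 ->
  cmeasurable (fun t => f1 t * f2 t).
Proof.
move=> [r1 i1] [r2 i2].
split.
  by under eq_fun do rewrite Re_mul; apply: measurable_funB; exact: measurable_funM.
by under eq_fun do rewrite Im_mul; apply: measurable_funD; exact: measurable_funM.
Qed.

Lemma cmeasurable_conjc (f : R -> R[i]) : cmeasurable f ->
  cmeasurable (fun t => conjc (f t)).
Proof.
move=> [r i]; split; first by under eq_fun do rewrite Re_conjc.
by under eq_fun do rewrite Im_conjc; exact: measurable_funN.
Qed.

Lemma measurable_sqr_cabs (f : R -> R[i]) : cmeasurable f ->
  measurable_fun T (fun t => cabs (f t) ^+ 2).
Proof.
move=> [r i]; under eq_fun do rewrite sqr_cabs.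
by apply: measurable_funD; exact: measurable_funX.
Qed.

Lemma measurable_cabs (f : R -> R[i]) : cmeasurable f ->
  measurable_fun T (fun t => cabs (f t)).
Proof.
move=> /measurable_sqr_cabs mf.
have E z : cabs z = Num.sqrt (cabs z ^+ 2) :> R by rewrite sqrtr_sqr ger0_norm ?cabs_ge0.
under eq_fun do rewrite E.
apply: measurableT_comp mf.
exact: continuous_measurable_fun (@sqrt_continuous R).
Qed.

Lemma mx_measurableP g : (forall t, SU11 (g t)) ->
  cmeasurable (fun t => g t 0 0) -> cmeasurable (fun t => g t 0 1) ->
  mx_measurable g.
Proof.
move=> sg m0 m1 i j.
have ordE (k : 'I_2) : k = 0 \/ k = 1.
  by case: k => [[|[|//]] kP]; [left|right]; apply/val_inj.
case: (ordE i) (ordE j) => -> [] -> //.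
- suff : cmeasurable (fun t => g t 1 0) by [].
  rewrite (_ : (fun _ => _) = fun t => conjc (g t 0 1)).
    exact: cmeasurable_conjc.
  by apply/funext => t; have [_ [-> _]] := sg t.
- suff : cmeasurable (fun t => g t 1 1) by [].
  rewrite (_ : (fun _ => _) = fun t => conjc (g t 0 0)).
    exact: cmeasurable_conjc.
  by apply/funext => t; have [-> _] := sg t.
Qed.

Lemma quot00 (G H : 'M[R[i]]_2) : SU11 G -> SU11 H -> (invmx G *m H) 0 0 =
  conjc (G 0 0) * H 0 0 + (- G 0 1) * conjc (H 0 1).
Proof.
move=> /SU11P [GE hG] /SU11P [HE _].
by rewrite {1}GE {1}HE invmx_conj_mx2 // conj_mx2M !mx2E.
Qed.

Lemma quot01 (G H : 'M[R[i]]_2) : SU11 G -> SU11 H -> (invmx G *m H) 0 1 =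
  conjc (G 0 0) * H 0 1 + (- G 0 1) * conjc (H 0 0).
Proof.
move=> /SU11P [GE hG] /SU11P [HE _].
by rewrite {1}GE {1}HE invmx_conj_mx2 // conj_mx2M !mx2E.
Qed.

Lemma cmeasurable_quot g h : (forall t, T t -> SU11 (g t)) -> (forall t, T t -> SU11 (h t)) ->
  mx_measurable g -> mx_measurable h ->
  cmeasurable (fun t => (invmx (g t) *m h t) 0 0) /\
  cmeasurable (fun t => (invmx (g t) *m h t) 0 1).
Proof.
move=> sg sh mg mh.
have ext (f1 f2 : R -> R[i]) : (forall t, T t -> f1 t = f2 t) -> cmeasurable f1 -> cmeasurable f2.
  move=> e [r i]; split; [move: r|move: i]; apply: eq_measurable_fun => t;
    by rewrite inE => Tt; rewrite e.
have mN (f : R -> R[i]) : cmeasurable f -> cmeasurable (fun t => - f t).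
  move=> mf; apply: ext (cmeasurableM (cmeasurable_cst (-1)) mf) => t _.
  by rewrite mulN1r.
split.
  apply: (ext _ _ (fun t Tt => esym (quot00 (sg t Tt) (sh t Tt)))).
  apply: cmeasurableD; apply: cmeasurableM.
  - by apply: cmeasurable_conjc; exact: mg.
  - exact: mh.
  - by apply: mN; exact: mg.
  - by apply: cmeasurable_conjc; exact: mh.
apply: (ext _ _ (fun t Tt => esym (quot01 (sg t Tt) (sh t Tt)))).
apply: cmeasurableD; apply: cmeasurableM.
- by apply: cmeasurable_conjc; exact: mg.
- exact: mh.
- by apply: mN; exact: mg.
- by apply: cmeasurable_conjc; exact: mh.
Qed.

Lemma measurable_dist1 g : cmeasurable (fun t => g t 0 0) ->
  cmeasurable (fun t => g t 0 1) -> measurable_fun T (fun t => dist1 (g t)).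
Proof.
move=> m0 m1; apply: measurable_funD; apply: measurable_cabs => //.
exact: cmeasurableD (cmeasurable_cst _).
Qed.

Lemma measurable_energy1 g : cmeasurable (fun t => g t 0 0) ->
  cmeasurable (fun t => g t 0 1) -> measurable_fun T (fun t => energy1 (g t)).
Proof.
move=> m0 m1; apply: measurable_funD; apply: measurable_sqr_cabs => //.
exact: cmeasurableD (cmeasurable_cst _).
Qed.

Lemma measurable_rho_powR (p : R) g h :
  (forall t, T t -> SU11 (g t)) -> (forall t, T t -> SU11 (h t)) ->
  mx_measurable g -> mx_measurable h ->
  measurable_fun T (fun t => (rho (g t) (h t) `^ p)%:E).
Proof.
move=> sg sh mg mh; apply/measurable_EFinP.
apply: (measurableT_comp (measurable_powR p)).
apply: (eq_measurable_fun (fun t => ln (1 + dist1 (invmx (g t) *m h t)))).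
  by move=> t; rewrite inE => Tt; rewrite rhoE; [|exact: sg|exact: sh].
apply: (measurableT_comp (@measurable_ln R)).
apply: measurable_funD; first exact: measurable_cst.
by have [m0 m1] := cmeasurable_quot sg sh mg mh; exact: measurable_dist1.
Qed.

End Measurability.

(** * Necessity: convergence forces square-summable coefficients *)

Section Necessity.
Variables (R : realType) (m : nat -> nat) (A : nat -> R) (B : nat -> R[i]) (p : R).
Hypothesis m_gt0 : forall j, (0 < m j)%N.
Hypothesis m_lac : forall j, (2 * m j <= m j.+1)%N.
Hypothesis A_gt0 : forall j, 0 < A j.
Hypothesis AB1 : forall j, A j ^+ 2 - cabs (B j) ^+ 2 = 1.
Hypothesis p_gt0 : 0 < p.

Local Notation mu := (@lebesgue_measure R).
Local Notation T := (@torus R).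
Local Notation block := (block m A B).
Local Notation g_ := (gN A B m).
Local Notation lnS2 := (sumlnS2 A B).

Lemma SU11_gN N t : SU11 (g_ N t).
Proof. by rewrite gN_block; exact: SU11_block. Qed.

Lemma rho_gN M N t : (M <= N)%N ->
  rho (g_ M t) (g_ N t) = ln (1 + dist1 (block M N t)).
Proof.
by move=> MN; rewrite rhoE; [rewrite !gN_block blockV_cat| |]; try exact: SU11_gN.
Qed.

Lemma cmeasurable_block M N : (M <= N)%N ->
  cmeasurable (fun t => block M N t 0 0) /\ cmeasurable (fun t => block M N t 0 1).
Proof.
move=> MN.
have cm (f : R -> R) : continuous f -> measurable_fun T f.
  move=> cf; apply: (measurable_funS measurableT) => //.
  exact: continuous_measurable_fun.
by have [c1 c2 c3 c4] := block_continuous m_gt0 m_lac A_gt0 AB1 MN; split; split; apply: cm.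
Qed.

Lemma mx_measurable_gN N : mx_measurable (g_ N).
Proof.
have [h0 h1] := cmeasurable_block (leq0n N).
apply: mx_measurableP => [t||]; first exact: SU11_gN.
  by rewrite (_ : (fun _ => _) = fun t => block 0 N t 0 0) //; apply/funext => t; rewrite gN_block.
by rewrite (_ : (fun _ => _) = fun t => block 0 N t 0 1) //; apply/funext => t; rewrite gN_block.
Qed.

(** The last distance runs from [k] to [h], by symmetry of [rho], so that two estimates towards a
    common limit [h] can be added. *)
Lemma rho_int_triangle (g h k : R -> 'M[R[i]]_2) :
  (forall t, T t -> SU11 (g t)) -> (forall t, T t -> SU11 (h t)) ->
  (forall t, T t -> SU11 (k t)) ->
  mx_measurable g -> mx_measurable h -> mx_measurable k ->
  (rho_int p g k <= (2 `^ p)%:E * (rho_int p g h + rho_int p k h))%E.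
Proof.
move=> sg sh sk mg mh mk.
have mT := @measurable_torus R.
rewrite /rho_int -ge0_integralD //; last 4 first.
- by move=> t _; rewrite lee_fin powR_ge0.
- exact: measurable_rho_powR.
- by move=> t _; rewrite lee_fin powR_ge0.
- exact: measurable_rho_powR.
rewrite -ge0_integralZl_EFin ?powR_ge0 //; last 2 first.
- by move=> t _; rewrite adde_ge0 // lee_fin powR_ge0.
- by apply: emeasurable_funD; exact: measurable_rho_powR.
apply: ge0_le_integral => //.
- by move=> t _; rewrite lee_fin powR_ge0.
- exact: measurable_rho_powR.
- by apply: measurable_funeM; apply: emeasurable_funD; exact: measurable_rho_powR.
move=> t Tt; rewrite lee_fin (rhoC (sk t Tt) (sh t Tt)).
apply: le_trans (powRD_le p_gt0 _ _); rewrite ?rho_ge0 //; try by [exact: sg|exact: sh|exact: sk].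
apply: ge0_ler_powR; rewrite ?nnegrE ?addr_ge0 ?rho_ge0 ?(ltW p_gt0) //; try by [exact: sg|exact: sh|exact: sk].
by apply: rho_triangle; [exact: sg|exact: sh|exact: sk].
Qed.

Lemma integral_torus_cst (c : R) : (\int[mu]_(t in T) c%:E = c%:E)%E.
Proof.
have := integral_cst mu (@measurable_torus R) c%:E.
by rewrite [X in (_ * X)%E]mu_torus mule1.
Qed.

(** For a single factor the distance is constant in t: [1 + dist1] equals A + |B|, hence is at least
    A. *)
Lemma rho_int_gN_recr_ge M :
  (((ln (A M)) `^ p)%:E <= rho_int p (g_ M) (g_ M.+1))%E.
Proof.
rewrite -integral_torus_cst; apply: ge0_le_integral => //.
- exact: measurable_torus.
- by move=> t _; rewrite lee_fin powR_ge0.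
- by apply: measurable_rho_powR => *; try exact: SU11_gN; exact: mx_measurable_gN.
move=> t _; rewrite lee_fin; have A1 := A_ge1 A_gt0 AB1 M.
rewrite rho_gN // block_recr // block_nil mul1mx factorE /dist1 !mx2E.
have hd : A M <= 1 + (cabs ((A M)%:C%C - 1) + cabs (B M * mode (m M) t)).
  rewrite (_ : (A M)%:C%C - 1 = ((A M - 1)%:C)%C) ?cabs_real ?subr_ge0 //; last by rewrite rmorphB.
  by rewrite addrA addrCA subrr addr0 lerDl cabs_ge0.
apply: ge0_ler_powR; rewrite ?nnegrE ?(ltW p_gt0) ?ln_ge0 //.
  exact: le_trans hd.
rewrite ler_ln ?posrE //; apply: lt_le_trans hd; exact: A_gt0.
Qed.

Lemma lnS2_recr_le M : ln (A M) <= 1 / 4 -> lnS2 M M.+1 <= 1.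
Proof.
move=> h; rewrite /sumlnS2 big_nat1; have A0 := A_gt0 M.
have S1 := S2_ge1 AB1 M.
apply: (@le_trans _ _ (ln (A M ^+ 4))).
  rewrite ler_ln ?posrE ?exprn_gt0 ?(lt_le_trans _ S1) // S2E //.
  rewrite -subr_ge0 (_ : _ - _ = (A M ^+ 2 - 1) ^+ 2) ?sqr_ge0 //; ring.
by rewrite lnXn // -mulr_natl; lra.
Qed.

(* The mean of [|a|] is at least [prod A], bounded
   away from [1], while its second moment stays bounded, so [|a|] cannot be
   close to [1] in measure. *)
Lemma rho_int_gN_lower : exists d : R, 0 < d /\ forall M N, (M <= N)%N ->
  1 <= lnS2 M N <= 2 -> (d%:E < rho_int p (g_ M) (g_ N))%E.
Proof.
(* [1/4] is the excess over 1 of the mean of Re a, which is at least exp(1/4) >= 5/4; [expR 2]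
   bounds the mean energy. If the integral of [f] were at most [1 / (16 * D)], each of the three
   terms in [hD] would integrate to at most 1/16, and 5/4 <= 1 + 3/16 would follow. *)
have [D [D0 hD]] := @ln1p_powR_lower R p (1/4) (expR 2) p_gt0 ltac:(lra) (expR_gt0 2).
exists (1 / (16 * D)); split; first by rewrite divr_gt0 // mulr_gt0.
move=> M N MN /andP[l1 l2]; rewrite ltNge; apply/negP => hle.
have mT := @measurable_torus R.
pose f t := rho (g_ M t) (g_ N t) `^ p.
have mf : measurable_fun T (EFin \o f).
  by apply: measurable_rho_powR => *; try exact: SU11_gN; exact: mx_measurable_gN.
have f0 t : 0 <= f t by exact: powR_ge0.
have intf : mu.-integrable T (EFin \o f).
  apply/integrableP; split => //; under eq_integral do rewrite /= ger0_norm //.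
  exact: le_lt_trans hle (ltry _).
have [ca _ _ _] := block_continuous m_gt0 m_lac A_gt0 AB1 MN.
have ce := continuous_energy m_gt0 m_lac A_gt0 AB1 MN.
set k := 1 / 4 / (4 * expR 2) in hD.
have k0 : 0 <= k by rewrite !divr_ge0 // mulr_ge0 // expR_ge0.
have c1 : continuous ((fun=> 17 / 16) : R -> R) by move=> t; exact: cst_continuous.
have hp t : T t -> complex.Re (block M N t 0 0) <=
   (17 / 16 + k * energy (block M N t)) + D * f t.
  move=> _; have /SU11P [_ h1] := SU11_block m A_gt0 AB1 M N t.
  set a := block M N t 0 0 in h1 *; set b := block M N t 0 1 in h1 *.
  have a1 : 1 <= cabs a.
    rewrite -(ler_pXn2r (n := 2)) ?nnegrE ?cabs_ge0 // expr1n.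
    by have := sqr_ge0 (cabs b); lra.
  have y0 : 0 <= cabs a - 1 by rewrite subr_ge0.
  have h2 : k * (cabs a - 1) ^+ 2 <= k * energy (block M N t).
    apply: ler_wpM2l => //; rewrite /energy -/a -/b.
    by have := sqr_ge0 (cabs b); nra.
  have h3 : D * ln (1 + (cabs a - 1)) `^ p <= D * f t.
    apply: ler_wpM2l; first exact: ltW.
    rewrite /f rho_gN //; apply: ge0_ler_powR; rewrite ?nnegrE ?(ltW p_gt0) ?ln_ge0 ?lerDl ?dist1_ge0 //.
    rewrite ler_ln ?posrE ?ltr_pwDl ?dist1_ge0 // lerD2l /dist1 -/a -/b.
    have := cabsD (a - 1) 1; rewrite subrK cabs1 => h.
    by have := cabs_ge0 b; lra.
  have h4 := le_Re_cabs a; have := hD _ y0; lra.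
have i1 := continuous_torus_integrable c1.
have i2 := continuous_torus_integrable (@continuous_scale _ k _ ce).
have i12 := continuous_torus_integrable (continuous_add c1 (@continuous_scale _ k _ ce)).
have i3 : mu.-integrable T (EFin \o (fun t => D * f t)).
  exact: (@integrableZl _ _ _ mu T mT D (EFin \o f) intf).
have := @le_Rintegral _ _ _ mu T _ _ mT (continuous_torus_integrable ca)
  (@integrableD _ _ _ mu T mT _ _ i12 i3) hp.
rewrite RintegralD // RintegralD // (@RintegralZl _ _ _ mu T f D) //.
rewrite (@RintegralZl _ _ _ mu T (fun t => energy (block M N t)) k) //; last first.
  exact: continuous_torus_integrable.
rewrite Rintegral_torus_cst Rintegral_block00 // Rintegral_energy // prod_S2 //.
have hA := prod_A_ge A_gt0 AB1 M N.
have e1 : 5 / 4 <= expR (lnS2 M N / 4).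
  have := expR_ge1Dx (lnS2 M N / 4); lra.
have e2 : k * expR (lnS2 M N) <= 1 / 16.
  apply: le_trans (_ : k * expR 2 <= _).
    by rewrite ler_wpM2l // ler_expR.
  by rewrite /k (_ : _ * _ = 1 / 16) //; field; rewrite gt_eqF // expR_gt0.
have e3 : D * \int[mu]_(t in T) f t <= 1 / 16.
  have : \int[mu]_(t in T) f t <= 1 / (16 * D).
    rewrite -lee_fin fineK //; exact: integrable_fin_num.
  move=> /(ler_wpM2l (ltW D0)) /le_trans; apply.
  by rewrite div1r invfM mulrCA divff ?gt_eqF // mulr1 div1r.
move=> h; have := le_trans (le_trans e1 hA) h.
have := lerD (lerD (lexx (17 / 16 : R)) e2) e3 => h3 h4.
by have := le_trans h4 h3; rewrite leNgt => /negP; apply; lra.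
Qed.

(** The sums start at 0 and grow by at most 1 at each step, so they cannot jump over the window from
    1 to 2; landing in it contradicts [rho_int_gN_lower]. *)
Lemma lnS2_le1_of_cauchy : 
  (forall d : R, 0 < d -> exists N0, forall M N, (N0 <= M)%N -> (M <= N)%N ->
     (rho_int p (g_ M) (g_ N) <= d%:E)%E) ->
  exists N0, forall N, (N0 <= N)%N -> lnS2 N0 N <= 1.
Proof.
move=> hC; have [d1 [d1_gt0 hd1]] := rho_int_gN_lower.
have d2_gt0 : 0 < (1 / 4 : R) `^ p by rewrite powR_gt0 // divr_gt0.
(* [d1] forbids the window. The other bound forces ln A <= 1/4 for single factors, and then ln S2 <=
   1 because S2 = 2 A^2 - 1 <= A^4. *)
have [N0 hN0] := hC (Num.min d1 ((1 / 4) `^ p)) ltac:(by rewrite lt_min d1_gt0).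
have lnA N : (N0 <= N)%N -> ln (A N) <= 1 / 4.
  move=> N0N; have lA0 : 0 <= ln (A N) by rewrite ln_ge0 //; exact: A_ge1 A_gt0 AB1 _.
  have := le_trans (rho_int_gN_recr_ge N) (hN0 N N.+1 N0N (leqnSn N)).
  rewrite lee_fin le_min => /andP[_]; apply: contraTT; rewrite -!ltNge => h.
  by apply: gt0_ltr_powR => //; rewrite nnegrE divr_ge0.
exists N0 => N /subnKC <-; elim: (N - N0)%N => [|k ih].
  by rewrite addn0 /sumlnS2 big_geq.
rewrite addnS; set N' := (N0 + k)%N in ih *.
have N0N' : (N0 <= N')%N by rewrite leq_addr.
rewrite leNgt; apply/negP => gt1.
have le2 : lnS2 N0 N'.+1 <= 2.
  have := lnS2_recr_le (lnA _ N0N'); rewrite /sumlnS2 big_nat1 => h.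
  by rewrite big_nat_recr //= (_ : 2 = 1 + 1) // lerD.
have := hd1 N0 N'.+1 (leqW N0N'); rewrite (ltW gt1) le2 => /(_ isT).
apply/negP; rewrite -leNgt.
apply: le_trans (hN0 N0 N'.+1 (leqnn _) (leqW N0N')) _.
by rewrite lee_fin ge_min lexx.
Qed.

Lemma converges_Lp_cauchy : converges_Lp p g_ ->
  forall d : R, 0 < d -> exists N0, forall M N, (N0 <= M)%N -> (M <= N)%N ->
     (rho_int p (g_ M) (g_ N) <= d%:E)%E.
Proof.
move=> [_ [g [[mg [sg _]] /(dp_cvg0P _ _ p_gt0) cg]]] d d0.
have K0 : 0 < (2 : R) `^ p by rewrite powR_gt0.
have [N0 hN0] := cg (d / (2 * 2 `^ p)) ltac:(by rewrite divr_gt0 // mulr_gt0).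
exists N0 => M N N0M MN; apply: le_trans (@rho_int_triangle _ g _ _ _ _ _ _ _) _ => //.
- by move=> t _; exact: SU11_gN.
- by move=> t _; exact: SU11_gN.
- exact: mx_measurable_gN.
- exact: mx_measurable_gN.
have := leeD (hN0 M N0M) (hN0 N (leq_trans N0M MN)).
move=> /(lee_wpmul2l (x := (2 `^ p)%:E)) => /(_ (ltW K0)) /le_trans; apply.
rewrite -EFinD -EFinM lee_fin [leLHS](_ : _ = d) //; field.
by rewrite gt_eqF.
Qed.

Lemma converges_Lp_summable : converges_Lp p g_ ->
  (\sum_(0 <= j <oo) (ln (S2 A B j))%:E < +oo)%E.
Proof.
move=> /converges_Lp_cauchy /lnS2_le1_of_cauchy [N0 hN0].
apply: le_lt_trans (ltry (lnS2 0 N0 + 1)).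
have ln0 j : 0 <= ln (S2 A B j) by rewrite ln_ge0 // S2_ge1.
apply: lime_le; first by apply: is_cvg_nneseries => j _ _; rewrite lee_fin.
exists N0 => // N /= N0N.
rewrite sumEFin lee_fin (big_cat_nat (leq0n N0) N0N) /= lerD2l.
exact: hN0.
Qed.

End Necessity.

(** * Pointwise limits of sequences in SU(1,1) *)

Section PointwiseLimits.
Variable R : realType.

Lemma cvg_summable_steps (u x : nat -> R) (C X : R) : 0 <= C ->
  (forall k, 0 <= x k) -> (forall n, \sum_(0 <= k < n) x k <= X) ->
  (forall k, `|u k.+1 - u k| <= C * x k) -> cvgn u.
Proof.
move=> C0 x0 hX hu.
have cx : cvgn (series (fun k => C * x k)).
  apply: nondecreasing_is_cvgn.
    by apply: nondecreasing_series => k _ _; rewrite mulr_ge0.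
  exists (C * X) => _ [n _ <-]; rewrite /series /= -mulr_sumr.
  exact: ler_wpM2l.
have cs : cvgn (series (telescope u)).
  apply: normed_cvg; apply: series_le_cvg cx => k; rewrite ?mulr_ge0 ?normr_ge0 //.
  exact: hu.
have : cvgn (fun n => u 0%N + series (telescope u) n).
  by apply: is_cvgD => //; exact: is_cvg_cst.
by rewrite (_ : (fun _ => _) = u) //; apply/funext => n; rewrite -eq_sum_telescope.
Qed.

Definition ccvg (f : nat -> R[i]) (l : R[i]) :=
  ((fun k => complex.Re (f k)) @ \oo --> complex.Re l) /\
  ((fun k => complex.Im (f k)) @ \oo --> complex.Im l).

Lemma ccvg_cst c : ccvg (fun=> c) c.
Proof. by split; exact: cvg_cst. Qed.

Lemma ccvgD f1 f2 l1 l2 : ccvg f1 l1 -> ccvg f2 l2 ->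
  ccvg (fun k => f1 k + f2 k) (l1 + l2).
Proof.
move=> [r1 i1] [r2 i2]; split.
  by rewrite Re_add; under eq_fun do rewrite Re_add; exact: cvgD.
by rewrite Im_add; under eq_fun do rewrite Im_add; exact: cvgD.
Qed.

Lemma ccvgM f1 f2 l1 l2 : ccvg f1 l1 -> ccvg f2 l2 ->
  ccvg (fun k => f1 k * f2 k) (l1 * l2).
Proof.
move=> [r1 i1] [r2 i2]; split.
  rewrite Re_mul; under eq_fun do rewrite Re_mul.
  by apply: cvgB; exact: cvgM.
rewrite Im_mul; under eq_fun do rewrite Im_mul.
by apply: cvgD; exact: cvgM.
Qed.

Lemma ccvg_conjc f l : ccvg f l -> ccvg (fun k => conjc (f k)) (conjc l).
Proof.
move=> [r i]; split.
  by rewrite Re_conjc; under eq_fun do rewrite Re_conjc.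
by rewrite Im_conjc; under eq_fun do rewrite Im_conjc; exact: cvgN.
Qed.

Lemma ccvg_sqr_cabs f l : ccvg f l ->
  (fun k => cabs (f k) ^+ 2) @ \oo --> cabs l ^+ 2.
Proof.
move=> [r i]; rewrite sqr_cabs; under eq_fun do rewrite sqr_cabs.
by apply: cvgD; under eq_fun do rewrite expr2; rewrite expr2; exact: cvgM.
Qed.

Lemma SU11_ccvg (a b : nat -> R[i]) (la lb : R[i]) : ccvg a la -> ccvg b lb ->
  (forall k, cabs (a k) ^+ 2 - cabs (b k) ^+ 2 = 1) -> SU11 (conj_mx2 la lb).
Proof.
move=> ca cb h; apply: SU11_conj_mx2.
have : (fun k => cabs (a k) ^+ 2 - cabs (b k) ^+ 2) @ \oo -->
    cabs la ^+ 2 - cabs lb ^+ 2 by apply: cvgB; exact: ccvg_sqr_cabs.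
under eq_fun do rewrite h.
by move=> /(cvg_lim (@Rhausdorff R)) <-; rewrite lim_cst //; exact: Rhausdorff.
Qed.

Lemma energy1_quot_cvg (H G : 'M[R[i]]_2) (G_ : nat -> 'M[R[i]]_2) :
  SU11 H -> SU11 G -> (forall k, SU11 (G_ k)) ->
  ccvg (fun k => G_ k 0 0) (G 0 0) -> ccvg (fun k => G_ k 0 1) (G 0 1) ->
  (fun k => energy1 (invmx H *m G_ k)) @ \oo --> energy1 (invmx H *m G).
Proof.
move=> sH sG sG_ c0 c1.
rewrite /energy1 quot00 // quot01 //.
under eq_fun do rewrite quot00 // quot01 //.
apply: cvgD; apply: ccvg_sqr_cabs.
  apply: ccvgD (ccvg_cst _); apply: ccvgD; apply: ccvgM => //;
    try exact: ccvg_cst; exact: ccvg_conjc.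
by apply: ccvgD; apply: ccvgM => //; try exact: ccvg_cst; exact: ccvg_conjc.
Qed.

(* The operator norms [|a| + |b|] grow at most by the factors [1 + x k], hence
   stay bounded, and then left invariance bounds the increments of the entries
   by a multiple of [x k]. *)
Lemma SU11_cvg (G : nat -> 'M[R[i]]_2) (X : R) : (forall k, SU11 (G k)) ->
  (forall n, \sum_(0 <= k < n) dist1 (invmx (G k) *m G k.+1) <= X) ->
  exists la lb, ccvg (fun k => G k 0 0) la /\ ccvg (fun k => G k 0 1) lb.
Proof.
move=> sG hX; pose x k := dist1 (invmx (G k) *m G k.+1).
have x0 k : 0 <= x k by exact: dist1_ge0.
pose n_ k := cabs (G k 0 0) + cabs (G k 0 1).
have n0 k : 0 <= n_ k by rewrite addr_ge0 ?cabs_ge0.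
have step k : cabs (G k.+1 0 0 - G k 0 0) + cabs (G k.+1 0 1 - G k 0 1) <= n_ k * x k.
  have := SU11_step (sG k) (SU11_mul (SU11_inv (sG k)) (sG k.+1)).
  by rewrite mulmxA mulmxV ?mul1mx // SU11_unit.
have nS k : n_ k.+1 <= n_ k * (1 + x k).
  have h1 := cabsD (G k.+1 0 0 - G k 0 0) (G k 0 0).
  have h2 := cabsD (G k.+1 0 1 - G k 0 1) (G k 0 1).
  move: h1 h2 (step k); rewrite !subrK /n_; lra.
have nE k : n_ k <= n_ 0%N * expR (\sum_(0 <= j < k) x j).
  elim: k => [|k ih]; first by rewrite big_geq // expR0 mulr1.
  apply: le_trans (nS k) _; rewrite big_nat_recr //= expRD mulrA.
  by apply: ler_pM => //; [rewrite addr_ge0|exact: expR_ge1Dx].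
pose C := n_ 0%N * expR X.
have C0 : 0 <= C by rewrite mulr_ge0 ?expR_ge0.
have nC k : n_ k <= C.
  by apply: le_trans (nE k) _; rewrite ler_wpM2l // ler_expR; exact: hX.
have stepC k : cabs (G k.+1 0 0 - G k 0 0) + cabs (G k.+1 0 1 - G k 0 1) <= C * x k.
  by apply: le_trans (step k) _; rewrite ler_wpM2r.
have s0 k : cabs (G k.+1 0 0 - G k 0 0) <= C * x k.
  by apply: le_trans (stepC k); rewrite lerDl cabs_ge0.
have s1 k : cabs (G k.+1 0 1 - G k 0 1) <= C * x k.
  by apply: le_trans (stepC k); rewrite lerDr cabs_ge0.
have cc (f : nat -> R[i]) : (forall k, cabs (f k.+1 - f k) <= C * x k) ->
    exists l, ccvg f l.
  move=> hf.
  have cr : cvgn (fun k => complex.Re (f k)).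
    apply: (cvg_summable_steps C0 x0 hX) => k; apply: le_trans (hf k).
    by apply: le_trans (le_norm_Re_cabs _); rewrite Re_sub.
  have ci : cvgn (fun k => complex.Im (f k)).
    apply: (cvg_summable_steps C0 x0 hX) => k; apply: le_trans (hf k).
    by apply: le_trans (le_norm_Im_cabs _); rewrite Im_sub.
  exists (limn (fun k => complex.Re (f k)) +i* limn (fun k => complex.Im (f k)))%C.
  by split.
have [la hla] := cc _ s0; have [lb hlb] := cc _ s1.
by exists la, lb.
Qed.

End PointwiseLimits.

(** * Almost everywhere limits and Fatou's lemma *)

Section Completeness.
Variable R : realType.

Local Notation mu := (@lebesgue_measure R).
Local Notation T := (@torus R).

Lemma dist1_le (e : R) (G : 'M[R[i]]_2) : 0 < e -> dist1 G <= e + energy1 G / e.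
Proof.
move=> e0; rewrite -(ler_pM2r e0) [leRHS]mulrDl divfK ?gt_eqF // /dist1 /energy1.
have := cabs_ge0 (G 0 0 - 1); have := cabs_ge0 (G 0 1).
move: (cabs _) (cabs _) => x y x0 y0.
by have := sqr_ge0 (y - x); have := sqr_ge0 (y + x - e - e); nra.
Qed.

Lemma sqr_dist1_le (G : 'M[R[i]]_2) : dist1 G ^+ 2 <= 2 * energy1 G.
Proof.
rewrite /dist1 /energy1; move: (cabs _) (cabs _) => x y.
by have := sqr_ge0 (y - x); nra.
Qed.

Lemma energy1_ge0 (G : 'M[R[i]]_2) : 0 <= energy1 G.
Proof. by rewrite addr_ge0 ?sqr_ge0. Qed.

(** A form of the Cauchy-Schwarz inequality on a space of mass 1, obtained by integrating the
    pointwise bound [dist1_le]; the lost constant is harmless. *)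
Lemma integral_dist1_le (e : R) (G : R -> 'M[R[i]]_2) : 0 < e ->
  cmeasurable (fun t => G t 0 0) -> cmeasurable (fun t => G t 0 1) ->
  (\int[mu]_(t in T) (energy1 (G t))%:E <= (e ^+ 2)%:E)%E ->
  (\int[mu]_(t in T) (dist1 (G t))%:E <= (2 * e)%:E)%E.
Proof.
move=> e0 m0 m1 h; have mT := @measurable_torus R.
have e'0 : 0 <= e^-1 by rewrite invr_ge0 ltW.
have mE : measurable_fun T (fun t => (energy1 (G t))%:E).
  by apply/measurable_EFinP; exact: measurable_energy1.
have mE' : measurable_fun T (fun t => (e^-1)%:E * (energy1 (G t))%:E)%E.
  exact: measurable_funeM.
have E0 t : (0 <= (e^-1)%:E * (energy1 (G t))%:E)%E.
  by rewrite mule_ge0 // lee_fin // energy1_ge0.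
apply: le_trans (_ : \int[mu]_(t in T) (e%:E + (e^-1)%:E * (energy1 (G t))%:E) <= _)%E.
  apply: ge0_le_integral => //.
  - by move=> t _; rewrite lee_fin dist1_ge0.
  - apply/measurable_EFinP; exact: measurable_dist1.
  - by apply: emeasurable_funD => //; exact: measurable_cst.
  - by move=> t _; rewrite -EFinM -EFinD lee_fin mulrC; exact: dist1_le.
rewrite ge0_integralD //; last first.
  by move=> t _; rewrite lee_fin ltW.
rewrite integral_torus_cst ge0_integralZl_EFin //; last first.
  by move=> t _; rewrite lee_fin energy1_ge0.
rewrite mulr_natl mulr2n EFinD leeD2l //.
apply: le_trans (lee_wpmul2l _ h) _; first by rewrite lee_fin.
by rewrite -EFinM lee_fin expr2 mulKf // gt_eqF.
Qed.

Variable G : nat -> R -> 'M[R[i]]_2.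
Hypothesis SU11_G : forall k t, SU11 (G k t).
Hypothesis mG : forall k, mx_measurable (G k).

(** [H] stays fixed while [G k] runs: a bound on all the distances from [H] passes to the limit. The
    integral is restricted to [D], where convergence is known. *)
Lemma fatou_energy1 (D : set R) (H g : R -> 'M[R[i]]_2) (d : R) :
  measurable D -> D `<=` T -> (forall t, SU11 (H t)) -> mx_measurable H ->
  (forall t, SU11 (g t)) -> (forall t, D t ->
    ccvg (fun k => G k t 0 0) (g t 0 0) /\ ccvg (fun k => G k t 0 1) (g t 0 1)) ->
  (forall k, \int[mu]_(t in T) (energy1 (invmx (H t) *m G k t))%:E <= d%:E)%E ->
  (\int[mu]_(t in D) (energy1 (invmx (H t) *m g t))%:E <= d%:E)%E.
Proof.
move=> mD DT sH mH sg cg hd; have mT := @measurable_torus R.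
have mE k : measurable_fun T (fun t => (energy1 (invmx (H t) *m G k t))%:E).
  have [m0 m1] := @cmeasurable_quot R H (G k) (fun t _ => sH t) (fun t _ => SU11_G k t) mH (mG k).
  by apply/measurable_EFinP; exact: measurable_energy1.
have mED k : measurable_fun D (fun t => (energy1 (invmx (H t) *m G k t))%:E).
  exact: measurable_funS (mE k).
have E0 k t : (0 <= (energy1 (invmx (H t) *m G k t))%:E)%E by rewrite lee_fin energy1_ge0.
have -> : (\int[mu]_(t in D) (energy1 (invmx (H t) *m g t))%:E =
    \int[mu]_(t in D) limn_einf (fun k => (energy1 (invmx (H t) *m G k t))%:E))%E.
  apply: eq_integral => t; rewrite inE => Dt.
  have [c0 c1] := cg t Dt.
  have c := energy1_quot_cvg (sH t) (sg t) (SU11_G ^~ t) c0 c1.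
  have c2 : (fun k => (energy1 (invmx (H t) *m G k t))%:E) @ \oo -->
    (energy1 (invmx (H t) *m g t))%:E by apply: cvg_EFin c; exact: nearW.
  by rewrite (cvg_limn_einf_sup c2).1.
apply: le_trans (@fatou _ _ _ mu D mD _ mED (fun k t _ => E0 k t)) _.
rewrite limn_einf_lim; apply: lime_le.
  exact: is_cvg_einfs.
apply: nearW => n; apply: le_trans (_ : \int[mu]_(t in D) (energy1 (invmx (H t) *m G n t))%:E <= _)%E.
  by apply: ereal_inf_lbound; exists n => /=.
by apply: le_trans (hd n); apply: (@ge0_subset_integral _ _ _ mu D T mD mT _ (mE n)) => // t _; exact: E0.
Qed.

(** The squared bound on [energy1] becomes 2 / 2^(k+1) for the integral of [dist1]. The series of
    the [dist1] is therefore integrable, hence finite almost everywhere, and [SU11_cvg] applies at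
    each point where it is finite. *)
Lemma SU11_ae_limit :
  (forall k, \int[mu]_(t in T) (energy1 (invmx (G k t) *m G k.+1 t))%:E <=
     ((1 / (2 ^ k.+1)%:R) ^+ 2)%:E)%E ->
  exists D g, [/\ measurable D, D `<=` T, mu (T `\` D) = 0%E,
    forall t, SU11 (g t) & mx_measurable g] /\ forall t, D t ->
    ccvg (fun k => G k t 0 0) (g t 0 0) /\ ccvg (fun k => G k t 0 1) (g t 0 1).
Proof.
move=> hG; have mT := @measurable_torus R.
pose x k t := dist1 (invmx (G k t) *m G k.+1 t).
have x0 k t : (0 <= (x k t)%:E)%E by rewrite lee_fin dist1_ge0.
have mq k := @cmeasurable_quot R (G k) (G k.+1) (fun t _ => SU11_G k t)
  (fun t _ => SU11_G k.+1 t) (mG k) (mG k.+1).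
have mx k : measurable_fun T (fun t => (x k t)%:E).
  by have [m0 m1] := mq k; apply/measurable_EFinP; exact: measurable_dist1.
have ix k : (\int[mu]_(t in T) (x k t)%:E <= (2 / (2 ^ k.+1)%:R)%:E)%E.
  have [m0 m1] := mq k.
  rewrite (_ : 2 / _ = 2 * (1 / (2 ^ k.+1)%:R)); last by rewrite mulrA mulr1.
  by apply: integral_dist1_le => //; rewrite divr_gt0 // ltr0n expn_gt0.
pose F t := (\sum_(k <oo) (x k t)%:E)%E.
have F0 t : (0 <= F t)%E by apply: nneseries_ge0 => k _ _; exact: x0.
have mF : measurable_fun T F.
  rewrite /F; exact: (@ge0_emeasurable_sum _ _ _ T (fun k t => (x k t)%:E) xpredT).
have iF : mu.-integrable T F.
  apply/integrableP; split => //.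
  under eq_integral do rewrite gee0_abs //.
  rewrite /F integral_nneseries //.
  apply: le_lt_trans (lee_nneseries _ (fun k _ => ix k)) _.
    by move=> k _ _; apply: integral_ge0 => t _; exact: x0.
  exact: le_lt_trans (epsilon_trick0 _ (ler0n R 2)) (ltry _).
pose D := T `&` [set t | F t \is a fin_num].
have mD : measurable D by exact: emeasurable_fin_num.
have DT : D `<=` T by move=> t [].
have nullD : mu (T `\` D) = 0%E.
  have [N [mN N0 hN]] := @integrable_ae _ _ _ mu T mT F iF.
  apply: (subset_measure0 _ _ _ N0) => //; first exact: measurableD.
  move=> t [Tt nD]; apply: hN => /= h; apply: nD; split => //; exact: h.
have lim t : D t -> exists l, ccvg (fun k => G k t 0 0) l.1 /\ ccvg (fun k => G k t 0 1) l.2.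
  move=> [Tt Ft]; have hX n : \sum_(0 <= k < n) x k t <= fine (F t).
    rewrite -lee_fin fineK // -sumEFin; apply: nneseries_lim_ge => k _ _; exact: x0.
  have [la [lb h]] := SU11_cvg (SU11_G ^~ t) hX.
  by exists (la, lb).
(* The identity off [D] makes the limit SU(1,1)-valued at every point; being constant on [T] minus
   [D], it is also measurable there, so measurability is glued from two pieces. *)
pose g t := if pselect (D t) is left Dt then
  conj_mx2 (projT1 (cid (lim t Dt))).1 (projT1 (cid (lim t Dt))).2 else 1%:M.
have gl t : D t -> ccvg (fun k => G k t 0 0) (g t 0 0) /\ ccvg (fun k => G k t 0 1) (g t 0 1).
  move=> Dt; rewrite /g; case: pselect => // Dt'.
  by rewrite !mx2E; exact: (projT2 (cid (lim t Dt'))).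
have sg t : SU11 (g t).
  rewrite /g; case: pselect => [Dt|_]; last exact: SU11_1.
  have [c0 c1] := projT2 (cid (lim t Dt)).
  by apply: (SU11_ccvg c0 c1) => k; have /SU11P [] := SU11_G k t.
have gN t : ~ D t -> g t = 1%:M by rewrite /g; case: pselect.
have TE : T = D `|` (T `\` D) by rewrite setDUK.
have mTD : measurable (T `\` D) by exact: measurableD.
have mg (f : R -> R) (f_ : nat -> R -> R) (c : R) :
    (forall k, measurable_fun T (f_ k)) -> (forall t, D t -> (f_ ^~ t) @ \oo --> f t) ->
    (forall t, ~ D t -> f t = c) -> measurable_fun T f.
  move=> mf_ cf fc; rewrite TE; apply/measurable_funU => //; split.
    apply: (measurable_fun_cvg (h := f_)) => // k.
    exact: measurable_funS (mf_ k).
  apply: (eq_measurable_fun (fun=> c)); last exact: measurable_cst.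
  by move=> t; rewrite inE => -[_ nD]; rewrite fc.
exists D, g; split => //; split => //.
apply: mx_measurableP => //; split.
- apply: (mg _ (fun k t => complex.Re (G k t 0 0)) (complex.Re ((1%:M : 'M[R[i]]_2) 0 0))).
  + by move=> k; have [] := mG k 0 0.
  + by move=> t /gl [[]].
  + by move=> t /gN ->.
- apply: (mg _ (fun k t => complex.Im (G k t 0 0)) (complex.Im ((1%:M : 'M[R[i]]_2) 0 0))).
  + by move=> k; have [] := mG k 0 0.
  + by move=> t /gl [[]].
  + by move=> t /gN ->.
- apply: (mg _ (fun k t => complex.Re (G k t 0 1)) (complex.Re ((1%:M : 'M[R[i]]_2) 0 1))).
  + by move=> k; have [] := mG k 0 1.
  + by move=> t /gl [_ []].
  + by move=> t /gN ->.
- apply: (mg _ (fun k t => complex.Im (G k t 0 1)) (complex.Im ((1%:M : 'M[R[i]]_2) 0 1))).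
  + by move=> k; have [] := mG k 0 1.
  + by move=> t /gl [_ []].
  + by move=> t /gN ->.
Qed.

End Completeness.

(** * Sufficiency: square-summable coefficients give convergence *)

Section Sufficiency.
Variables (R : realType) (p : R).
Hypothesis p_gt0 : 0 < p.

Local Notation mu := (@lebesgue_measure R).
Local Notation T := (@torus R).

(** [C] is chosen before the functions and before [d], so [d] can be made small afterwards. A bound
    over a set [D] of full measure is all that Fatou's lemma will supply. *)
Lemma rho_int_le_energy1 (e : R) : 0 < e -> exists C : R, 0 <= C /\
  forall (g h : R -> 'M[R[i]]_2) (D : set R) (d : R),
  (forall t, SU11 (g t)) -> (forall t, SU11 (h t)) ->
  mx_measurable g -> mx_measurable h ->
  measurable D -> D `<=` T -> mu (T `\` D) = 0%E ->
  (\int[mu]_(t in D) (energy1 (invmx (g t) *m h t))%:E <= d%:E)%E ->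
  (rho_int p g h <= (e + C * d)%:E)%E.
Proof.
move=> e0; have [C [C0 hC]] := ln1p_powR_upper p_gt0 e0.
have C20 : 0 <= C * 2 by rewrite mulr_ge0.
exists (C * 2); split => // g h D d sg sh mg mh mD DT nullD hd.
have mT := @measurable_torus R.
have mTD : measurable (T `\` D) by exact: measurableD.
have mr := @measurable_rho_powR R p g h (fun t _ => sg t) (fun t _ => sh t) mg mh.
have r0 t : (0 <= (rho (g t) (h t) `^ p)%:E)%E by rewrite lee_fin powR_ge0.
have [m0 m1] := @cmeasurable_quot R g h (fun t _ => sg t) (fun t _ => sh t) mg mh.
have mE : measurable_fun D (fun t => (energy1 (invmx (g t) *m h t))%:E).
  apply: (measurable_funS mT DT).
  by apply/measurable_EFinP; exact: measurable_energy1.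
have E0 t : (0 <= (energy1 (invmx (g t) *m h t))%:E)%E by rewrite lee_fin energy1_ge0.
have CE0 t : (0 <= (C * 2)%:E * (energy1 (invmx (g t) *m h t))%:E)%E.
  by rewrite mule_ge0 // lee_fin.
have mCE : measurable_fun D (fun t => (C * 2)%:E * (energy1 (invmx (g t) *m h t))%:E)%E.
  exact: measurable_funeM.
rewrite /rho_int (@ge0_negligible_integral _ _ _ mu T (T `\` D) _ mTD mT mr (fun t _ => r0 t) nullD).
rewrite setDD setIidr //.
apply: le_trans (_ : \int[mu]_(t in D)
    (e%:E + (C * 2)%:E * (energy1 (invmx (g t) *m h t))%:E) <= _)%E.
  apply: ge0_le_integral => //.
  - exact: (measurable_funS mT DT).
  - by apply: emeasurable_funD => //; exact: measurable_cst.
  - move=> t _; rewrite -EFinM -EFinD lee_fin rhoE //.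
    apply: le_trans (hC _ (dist1_ge0 _)) _; rewrite lerD2l -mulrA ler_wpM2l //.
    exact: sqr_dist1_le.
rewrite ge0_integralD //; last by move=> t _; rewrite lee_fin ltW.
rewrite EFinD leeD //.
  rewrite -[leRHS]integral_torus_cst.
  apply: (@ge0_subset_integral _ _ _ mu D T mD mT (fun=> e%:E)) => //.
  by move=> t _; rewrite lee_fin ltW.
rewrite ge0_integralZl_EFin // [leRHS]EFinM.
by apply: (lee_wpmul2l _ hd); rewrite lee_fin.
Qed.

Variables (m : nat -> nat) (A : nat -> R) (B : nat -> R[i]).
Hypothesis m_gt0 : forall j, (0 < m j)%N.
Hypothesis m_lac : forall j, (2 * m j <= m j.+1)%N.
Hypothesis A_gt0 : forall j, 0 < A j.
Hypothesis AB1 : forall j, A j ^+ 2 - cabs (B j) ^+ 2 = 1.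

Local Notation block := (block m A B).
Local Notation g_ := (gN A B m).
Local Notation lnS2 := (sumlnS2 A B).

Lemma integral_energy1_gN M N : (M <= N)%N ->
  (\int[mu]_(t in T) (energy1 (invmx (g_ M t) *m g_ N t))%:E <=
   (expR (lnS2 M N) - 1)%:E)%E.
Proof.
move=> MN; under eq_integral do rewrite !gN_block blockV_cat //.
have ce := continuous_energy1 m_gt0 m_lac A_gt0 AB1 MN.
have fi := @integrable_fin_num _ _ _ mu T (@measurable_torus R) _ (continuous_torus_integrable ce).
rewrite -(fineK fi) lee_fin.
have := Rintegral_energy1 m_gt0 m_lac A_gt0 AB1 MN; rewrite /Rintegral /= => ->.
by rewrite prod_S2 //; have := prod_A_ge1 A_gt0 AB1 M N; lra.
Qed.

(** The identity is the empty product, so finiteness of the distance to it is the case M = 0 of the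
    block estimates. *)
Lemma Ifun_gN0 : @Ifun R = g_ 0.
Proof. by apply/funext => t; rewrite gN_block block_nil. Qed.

Lemma rho_int_gN_lty N : (rho_int p (@Ifun R) (g_ N) < +oo)%E.
Proof.
have [C [C0 hC]] := rho_int_le_energy1 ltr01.
have mgN := mx_measurable_gN m_gt0 m_lac A_gt0 AB1.
rewrite Ifun_gN0; apply: le_lt_trans (hC _ _ T _ _ _ _ _ _ _ _ (integral_energy1_gN (leq0n N))) (ltry _) => //;
  try by [move=> t; exact: SU11_gN|exact: mgN|exact: measurable_torus].
by rewrite setDv measure0.
Qed.

Lemma lnS2_tail : (\sum_(0 <= j <oo) (ln (S2 A B j))%:E < +oo)%E ->
  forall e : R, 0 < e -> exists N0, forall M N, (N0 <= M)%N -> (M <= N)%N ->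
    lnS2 M N <= e.
Proof.
move=> fin e e0; have ln0 j : 0 <= ln (S2 A B j) by rewrite ln_ge0 // S2_ge1.
pose V := [set lnS2 0 N | N in [set: nat]].
have supV : has_sup V.
  split; first by exists (lnS2 0 0), 0%N.
  exists (fine (\sum_(0 <= j <oo) (ln (S2 A B j))%:E)%E) => _ [N _ <-].
  rewrite -lee_fin fineK; last first.
    by rewrite ge0_fin_numE //; apply: nneseries_ge0 => j _ _; rewrite lee_fin.
  by rewrite -sumEFin; apply: nneseries_lim_ge => j _ _; rewrite lee_fin.
have [_ [N0 _ <-] hN0] := sup_adherent e0 supV.
exists N0 => M N N0M MN.
have hN : lnS2 0 N <= sup V by apply: ub_le_sup; [exact: supV.2|exists N].
have e1 : lnS2 0 N = lnS2 0 M + lnS2 M N.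
  by rewrite /sumlnS2 -big_cat_nat.
have e2 : lnS2 0 M = lnS2 0 N0 + lnS2 N0 M.
  by rewrite /sumlnS2 -big_cat_nat.
have := @lnS2_ge0 R A B AB1 N0 M; lra.
Qed.

Lemma energy1_tail : (\sum_(0 <= j <oo) (ln (S2 A B j))%:E < +oo)%E ->
  forall d : R, 0 < d -> exists N0, forall M N, (N0 <= M)%N -> (M <= N)%N ->
    (\int[mu]_(t in T) (energy1 (invmx (g_ M t) *m g_ N t))%:E <= d%:E)%E.
Proof.
move=> fin d d0.
have [N0 hN0] := lnS2_tail fin (e := ln (1 + d)) ltac:(by rewrite ln_gt0 // ltrDl).
exists N0 => M N N0M MN; apply: le_trans (integral_energy1_gN MN) _.
rewrite lee_fin lerBlDl; have := hN0 M N N0M MN.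
by rewrite -ler_expR lnK // posrE ltr_pwDl // ltW.
Qed.

(** The subsequence serves only to construct [g]. Fatou's lemma is then applied with a fixed [g_ M]
    against the subsequence, which gives an estimate for every late M and thus convergence of the
    whole sequence. *)
Lemma summable_converges_Lp :
  (\sum_(0 <= j <oo) (ln (S2 A B j))%:E < +oo)%E -> converges_Lp p g_.
Proof.
move=> fin; have mT := @measurable_torus R.
have sgN N t : SU11 (g_ N t) by exact: SU11_gN.
have mgN := mx_measurable_gN m_gt0 m_lac A_gt0 AB1.
split=> [N|]; first by split; [exact: mgN|split=> [t _|]; [exact: sgN|exact/dp_lty/rho_int_gN_lty]].
have [n hn] := choice (fun k : nat => energy1_tail fin
  (d := (1 / (2 ^ k.+1)%:R) ^+ 2) ltac:(by rewrite exprn_gt0 // divr_gt0 // ltr0n expn_gt0)).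
(* The running maximum makes the indices nondecreasing, keeps [K k] beyond the threshold [n k], and
   forces it to infinity through [K k >= k]. *)
pose K k := \max_(i < k.+1) maxn (n i) i.
have KS k : (K k <= K k.+1)%N by rewrite /K [leqRHS]big_ord_recr leq_maxl.
have Kge k : (maxn (n k) k <= K k)%N by rewrite /K big_ord_recr leq_maxr.
have hK k : (\int[mu]_(t in T) (energy1 (invmx (g_ (K k) t) *m g_ (K k.+1) t))%:E <=
    ((1 / (2 ^ k.+1)%:R) ^+ 2)%:E)%E.
  apply: hn => //; exact: leq_trans (leq_maxl _ _) (Kge k).
have [D [g [[mD DT nullD sg mg] cg]]] :=
  @SU11_ae_limit R (fun k => g_ (K k)) (fun k => sgN (K k)) (fun k => mgN (K k)) hK.
have lim_energy1 M d : (forall N, (M <= N)%N ->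
    (\int[mu]_(t in T) (energy1 (invmx (g_ M t) *m g_ N t))%:E <= d%:E)%E) ->
  (\int[mu]_(t in D) (energy1 (invmx (g_ M t) *m g t))%:E <= d%:E)%E.
  (* Shifting the subsequence by [M] puts all of its indices at [M] or beyond, where [hM] is
     available. *)
  move=> hM; apply: (@fatou_energy1 R (fun k => g_ (K (k + M)%N))) => //.
  - move=> t /cg [c0 c1]; split; split; [have := c0.1|have := c0.2|have := c1.1|have := c1.2];
    by rewrite -(cvg_shiftn M).
  - move=> k; apply: hM; apply: leq_trans (Kge _).
    by rewrite leq_max leq_addl orbT.
exists g; split.
  split => //; split => //; apply: dp_lty.
  have [C [C0 hC]] := rho_int_le_energy1 ltr01.
  rewrite Ifun_gN0.
  (* Finiteness of the distance from the identity needs one bound for all partial products; the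
     partial sums stay below [X], so every [energy1] has mean at most exp(X) - 1. *)
  have [X hX] : exists X : R, forall N, lnS2 0 N <= X.
    have [N0 hN0] := lnS2_tail fin ltr01; exists (lnS2 0 N0 + 1) => N.
    have [NN0|/ltnW N0N] := leqP N N0.
      rewrite /sumlnS2 (big_cat_nat (leq0n N) NN0) /= -addrA lerDl addr_ge0 //.
      exact: lnS2_ge0.
    by rewrite /sumlnS2 (big_cat_nat (leq0n N0) N0N) /= lerD2l; exact: hN0.
  apply: le_lt_trans (hC _ _ D (expR X - 1) _ _ _ _ _ _ _ _) (ltry _) => //.
  apply: lim_energy1 => N _; apply: le_trans (integral_energy1_gN (leq0n N)) _.
  by rewrite lee_fin lerD2r ler_expR.
apply/(dp_cvg0P _ _ p_gt0) => d d0; have d2 : 0 < d / 2 by rewrite divr_gt0.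
have [C [C0 hC]] := rho_int_le_energy1 d2.
have C1 : 0 < C + 1 by rewrite ltr_wpDl.
(* Half of [d] is spent on the constant term of [hC] and half on [C] times the mean energy; dividing
   by [C + 1] allows for C = 0. *)
have [N0 hN0] := energy1_tail fin (d := d / 2 / (C + 1)) ltac:(by rewrite divr_gt0).
exists N0 => M N0M.
apply: le_trans (hC (g_ M) g D (d / 2 / (C + 1)) _ _ _ _ _ _ _ _) _ => //.
  by apply: lim_energy1 => N; exact: hN0.
rewrite lee_fin [leRHS]splitr lerD2l mulrCA ger_pMr //.
by rewrite ler_pdivrMr // mul1r lerDl.
Qed.

End Sufficiency.

Theorem theorem1p1 (R : realType) (m : nat -> nat) (q p : R)
  (A : nat -> R) (B : nat -> R[i])
  (hm_pos : forall j, (0 < m j)%N)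
  (hm_incr : forall j, (m j < m j.+1)%N)
  (hq : 2 <= q)
  (hm_lac : forall j, q * (m j)%:R <= (m j.+1)%:R)
  (hp : 0 < p)
  (hA : forall j, 0 < A j)
  (hAB : forall j, A j ^+ 2 - cabs (B j) ^+ 2 = 1) :
  converges_Lp p (gN A B m) <->
  (\sum_(0 <= j <oo) (ln (A j ^+ 2 + cabs (B j) ^+ 2))%:E < +oo)%E.
Proof.
have m_lac j : (2 * m j <= m j.+1)%N.
  rewrite -(ler_nat R) natrM; apply: le_trans (hm_lac j).
  by rewrite ler_wpM2r.
split; first exact: converges_Lp_summable.
exact: summable_converges_Lp.
Qed.
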